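(* Let $w\in S_n$ have length $n-1$, and write its unique factorization into indecomposables $w=w_1\times w_2\times\cdots\times w_k$. For $1\le i\le k$ let $w^{(i)}=(w_i\times w_{i+1}\times\cdots\times w_k)\times(w_1\times\cdots\times w_{i-1})$. Then $$\sum_{i=1}^k a_{w^{(i)}}(q)=\sum_{\mathbf{a}\in\mathrm{Red}(w)}q^{\mathrm{comaj}(\mathbf{a})}.$$
   Context: For $u\in S_a$, $v\in S_b$, $u\times v\in S_{a+b}$ is given by $(u\times v)(i)=u(i)$ for $i\le a$ and $(u\times v)(a+j)=a+v(j)$ for $1\le j\le b$. A permutation is indecomposable if it is not of the form $u\times v$ with $u,v$ both in symmetric groups of positive size. $\mathfrak{S}_w$ is the Schubert polynomial ($\mathfrak{S}_{w_0}=x_1^{n-1}\cdots x_{n-1}$, $\mathfrak{S}_{ws_i}=\partial_i\mathfrak{S}_w$ when $w(i)>w(i+1)$, $\partial_i g=(g-s_ig)/(x_i-x_{i+1})$). The $q$-divided symmetrization is $\langle f\rangle_n^q=\sum_{w\in S_n}T_w\big(f/\prod_{j=1}^{n-1}(qx_j-x_{j+1})\big)$ with $T_j(g)=(q-1)\partial_j(x_jg)+s_jg$ and $T_w=T_{j_1}\cdots T_{j_\ell}$ for a reduced word; for $w\in S_n$ of length $n-1$, $a_w(q)=\langle\mathfrak{S}_w\rangle_n^q$ ($q$ an indeterminate). $\mathrm{Red}(w)$ is the set of reduced words of $w$ and $\mathrm{comaj}(a_1\cdots a_\ell)=\sum\{j: a_j<a_{j+1}\}$. *)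

(* Defs.v *)
From HB Require Import structures.
From mathcomp Require Import all_boot all_order all_algebra all_fingroup.
From mathcomp Require Import fraction zify.
From mathcomp Require Import mpoly.

Set Implicit Arguments.
Unset Strict Implicit.
Unset Printing Implicit Defensive.

Import GRing.Theory.
Local Open Scope ring_scope.

(* Elements of 'S_m are permutations of {0,..,m-1}; the paper's          *)
(* position i (1-based) is the ordinal i-1.  Composition as functions:   *)
(* (u \o v) corresponds to mathcomp's (v * u)%g.                          *)

Definition sperm (m i : nat) : 'S_m :=
  match m as m0 return 'S_m0 with
  | 0 => 1%g
  | m'.+1 => tperm (inord i.-1 : 'I_m'.+1) (inord i)
  end.

(* the permutation s_{a_1} s_{a_2} ... s_{a_l} (product of functions) *)
Fixpoint word_perm (m : nat) (a : seq nat) : 'S_m :=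
  match a with
  | [::] => 1%g
  | i :: l => (word_perm m l * sperm m i)%g
  end.

Definition len (m : nat) (w : 'S_m) : nat :=
  #|[set p : 'I_m * 'I_m | (p.1 < p.2)%N && (w p.2 < w p.1)%N]|.

Fixpoint words (m k : nat) : seq (seq nat) :=
  match k with
  | 0 => [:: [::]]
  | k'.+1 => [seq i :: s | i <- iota 1 m.-1, s <- words m k']
  end.

Definition Red (m : nat) (w : 'S_m) : seq (seq nat) :=
  [seq a <- words m (len w) | word_perm m a == w].

Definition comaj (a : seq nat) : nat :=
  (\sum_(j < (size a).-1) (if nth 0 a j < nth 0 a j.+1 then j.+1 else 0))%N.

Definition w0 (m : nat) : 'S_m := perm (@rev_ord_inj m).

Definition cross_fun (a b : nat) (u : 'S_a) (v : 'S_b) (x : 'I_(a + b))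
  : 'I_(a + b) :=
  match split x with
  | inl i => lshift b (u i)
  | inr j => rshift a (v j)
  end.

Lemma cross_fun_inj a b (u : 'S_a) (v : 'S_b) : injective (cross_fun u v).
Proof.
move=> x y; rewrite /cross_fun -{2}(splitK x) -{2}(splitK y).
case: (split x) => [i|j]; case: (split y) => [i'|j'] /= /(congr1 val) /=.
- by move=> /val_inj /perm_inj ->.
- by have := ltn_ord (u i); lia.
- by have := ltn_ord (u i'); lia.
- by move=> /eqP; rewrite eqn_add2l => /eqP /val_inj /perm_inj ->.
Qed.

Definition crossp (a b : nat) (u : 'S_a) (v : 'S_b) : 'S_(a + b) :=
  perm (@cross_fun_inj a b u v).

Definition SP := {m : nat & 'S_m}.

Definition crossS (x y : SP) : SP :=
  existT (fun m => 'S_m) (projT1 x + projT1 y)%N (crossp (projT2 x) (projT2 y)).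

Definition cross_list (ws : seq SP) : SP :=
  foldr crossS (existT (fun m => 'S_m) 0%N 1%g) ws.

Definition indecomposable (x : SP) : Prop :=
  ~ exists (a b : nat) (u : 'S_a) (v : 'S_b),
      [/\ (0 < a)%N, (0 < b)%N &
          crossS (existT _ a u) (existT _ b v) = x].

(* Rational functions.  Ambient ring: polynomials over Q in N+1 variables *)
(* x_1, ..., x_N (indices 0..N-1) and q (index N); K N is its fraction    *)
(* field.                                                                 *)

Definition Pol (N : nat) := {mpoly rat[N.+1]}.
Definition K (N : nat) := {fraction Pol N}.

Definition xP (N i : nat) : Pol N := 'X_(inord i.-1).
Definition qP (N : nat) : Pol N := 'X_(inord N).
Definition xK (N i : nat) : K N := tofrac (xP N i).
Definition qK (N : nat) : K N := tofrac (qP N).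

Definition swap_idx (N j : nat) (i : 'I_N.+1) : 'I_N.+1 :=
  if val i == j.-1 then inord j else if val i == j then inord j.-1 else i.
Definition sP (N j : nat) (p : Pol N) : Pol N :=
  p \mPo [tuple 'X_(swap_idx j i) | i < N.+1].

Definition sK (N j : nat) (g : K N) : K N :=
  tofrac (sP j (frac (generic_quotient.repr g)).1) / tofrac (sP j (frac (generic_quotient.repr g)).2).

Definition ddK (N j : nat) (g : K N) : K N :=
  (g - sK j g) / (xK N j - xK N j.+1).

Definition TK (N j : nat) (g : K N) : K N :=
  (qK N - 1) * ddK j (xK N j * g) + sK j g.

(* T_w = T_{j_1} ... T_{j_l} for a reduced word j_1...j_l of w
   (we use the first reduced word; T_w does not depend on the choice) *)
Definition Tw (N m : nat) (w : 'S_m) (g : K N) : K N :=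
  foldr (fun j h => TK j h) g (head [::] (Red w)).

(* Schubert polynomial: S_{w0} = x_1^{m-1} ... x_{m-1}, and
   S_{w s_i} = \partial_i S_w when w(i) > w(i+1).  If i_1...i_k is a reduced
   word of w0 w (so w = w0 s_{i_1} ... s_{i_k}, lengths decreasing), then
   S_w = \partial_{i_k} ... \partial_{i_1} S_{w0}. *)
Definition schub (N m : nat) (w : 'S_m) : K N :=
  foldl (fun g i => ddK i g)
        (\prod_(1 <= i < m) xK N i ^+ (m - i))
        (head [::] (Red (w * w0 m)%g)).

Definition qdivsym (N m : nat) (f : K N) : K N :=
  \sum_(w : 'S_m)
     @Tw N m w (f / \prod_(1 <= j < m) (qK N * xK N j - xK N j.+1)).

Definition a_ (N m : nat) (w : 'S_m) : K N := @qdivsym N m (@schub N m w).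

Definition aS (N : nat) (x : SP) : K N := @a_ N (projT1 x) (projT2 x).

(* Main.v *)
(* Write u_i = x_1 + .. + x_i, let phi be the q-divided symmetrization on polynomials
   of degree n - 1, and let J be the ideal generated by u_n and by the elements
   u_i (q x_i - x_(i+1)) (q-Klyachko relations).

   The sum of all T_w is proportional to the symmetrizer of prod (q x_i - x_j)/(x_i - x_j)
   over i < j, and for degree reasons phi vanishes on J.  Modulo J every polynomial f
   satisfies f(x) = sum_I (1-q)^|I| u_I (d_I f)(qx), over the decreasing words I in the
   divided differences d_i.  Iterating this identity gives the q-Macdonald formula
     [n-1]! a_w(q) = sum_(a in Red(w)) q^comaj(a) phi(u_a).
   A cyclic shift of the factors of w renames the letters of reduced words cyclically;
   the order of the alphabet changes only by exchanging two commuting blocks, which does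
   not affect the comaj distribution, so all a_(w^(i)) are sums over Red(w) with shifted
   monomials u_a.  Finally the sum of phi over the n cyclic shifts of a monomial of degree
   n - 1 in the u_i does not depend on the monomial: the relations in J say that it is
   harmonic for a biased walk on a cycle.  Its value is phi(u_1 .. u_(n-1)) = [n-1]!. *)

Require Import Defs.
From HB Require Import structures.
From mathcomp Require Import all_boot all_order all_algebra all_fingroup.
From mathcomp Require Import fraction generic_quotient.
From mathcomp Require Import mpoly.
From mathcomp Require Import zify ring.

Set Implicit Arguments.
Unset Strict Implicit.
Unset Printing Implicit Defensive.

Import GRing.Theory.
Local Open Scope ring_scope.

(** * Reduced words *)

(** The theorem has k rotations of w, whereas the harmonic argument needs all [n.+1] rotations of
    the alphabet (the theorem's n is [n.+1] in the sections below). The missing rotations contribute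
    nothing: if m is not a boundary between indecomposable factors, every reduced word contains the
    letter m, rotation by m sends it to 0, and [uu 0 = 0]. The vanishing on J rests on the
    self-adjointness of divided differences for an antisymmetric kernel: those of the longest
    element of S_i x S_(n+1-i) can be moved onto a polynomial of too small a degree. The formula for
    phi and the invariance of comaj come from one device. A comaj generating function of words is a
    fixed point of the q-Taylor expansion, and a fixed point is determined degree by degree because
    1 - q^l is invertible. It is stated for abstract states, and used with field elements under
    divided differences and with permutations under removal of descents. *)

Arguments sperm : simpl never.

(** Conditions that still contain an [if] are left for later, so composed transpositions are
    evaluated from the inside. *)
Ltac split_ifs := repeat match goal with
  | |- context [if (?a == ?b) then _ else _] =>
    lazymatch a with context [if _ then _ else _] => fail | _ => idtac end;
    case: (a =P b) => ? /=
  end.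

Lemma sum_ltn_minn j n : (\sum_(x < n) (x < j) = minn n j)%N.
Proof. by elim: n => [|n IH]; rewrite ?big_ord0 ?big_ord_recr /= ?IH; lia. Qed.

Section Permutations.
Variable n : nat.
Implicit Types (w v : 'S_n.+1) (a b : seq nat) (i j k m : nat).

Local Notation s := (sperm n.+1).
Local Notation letter i := (0 < i < n.+1)%N.
Local Notation wp := (word_perm n.+1).

Lemma sperm_val i (x : 'I_n.+1) : letter i ->
  s i x = (if x == i.-1 :> nat then i else if x == i :> nat then i.-1 else x) :> nat.
Proof.
case/andP=> i0 iN; rewrite /sperm; case: tpermP => [->|->|/eqP nx /eqP ny] /=.
- by rewrite !inordK ?eqxx //; lia.
- rewrite !inordK ?eqxx //; last by lia.
  by rewrite ifN //; lia.
- move: nx ny; rewrite -!val_eqE /= !inordK //; last by lia.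
  by move=> /negPf -> /negPf ->.
Qed.

Lemma sperm_inord i k : letter i -> (k < n.+1)%N ->
  s i (inord k) = inord (if k == i.-1 then i else if k == i then i.-1 else k).
Proof.
move=> li kn; apply: val_inj; rewrite /= sperm_val // inordK //.
case: (k =P i.-1) => ?; [|case: (k =P i) => ?]; rewrite inordK //; lia.
Qed.

Lemma sperm_l i : letter i -> s i (inord i.-1) = inord i.
Proof. by move=> li; rewrite sperm_inord ?eqxx //; lia. Qed.

Lemma sperm_r i : letter i -> s i (inord i) = inord i.-1.
Proof. by move=> li; rewrite sperm_inord ?eqxx ?ifN //; lia. Qed.

Lemma sperm_fix i k : letter i -> (k < n.+1)%N -> k != i.-1 -> k != i ->
  s i (inord k) = inord k.
Proof. by move=> li kn h1 h2; rewrite sperm_inord // !ifN. Qed.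

Lemma spermK i : (s i * s i)%g = 1%g.
Proof. exact: tperm2. Qed.

Lemma spermKl i w : (s i * (s i * w))%g = w.
Proof. by rewrite mulgA spermK mul1g. Qed.

Lemma sperm_comm i j : letter i -> letter j -> (i.+1 < j)%N ->
  (s i * s j = s j * s i)%g.
Proof.
move=> li lj ij; apply/permP => x; apply: val_inj.
rewrite !permM /= !sperm_val //.
by split_ifs; lia.
Qed.

Lemma sperm_braid i : letter i -> letter i.+1 ->
  (s i * (s i.+1 * s i) = s i.+1 * (s i * s i.+1))%g.
Proof.
move=> li lj; apply/permP => x; apply: val_inj.
rewrite !permM /= !sperm_val //=.
by split_ifs; lia.
Qed.

(** As a function [(s i * w)%g] is w followed on the right by s_i, so these are right descents, as
    in the recursion for Schubert polynomials. *)
Definition descent w i := (w (inord i) < w (inord i.-1))%N.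

Lemma descN w i : letter i -> ~~ descent w i = (w (inord i.-1) < w (inord i))%N.
Proof.
move=> li; rewrite /descent -leqNgt leq_eqVlt; case: eqP => //= /val_inj/perm_inj.
by move/(congr1 val); rewrite /= !inordK; lia.
Qed.

Lemma desc_sperm w i : letter i -> descent (s i * w)%g i = ~~ descent w i.
Proof.
by move=> li; rewrite descN // /descent !permM sperm_l // sperm_r.
Qed.

Lemma sperm_mono i (x y : 'I_n.+1) : letter i -> (x < y)%N ->
  (x, y) != (inord i.-1, inord i) -> (s i x < s i y)%N.
Proof.
move=> li xy; have vi : val (inord i : 'I_n.+1) = i by rewrite /= inordK //; lia.
have vi' : val (inord i.-1 : 'I_n.+1) = i.-1 by rewrite /= inordK //; lia.
rewrite xpair_eqE -!val_eqE vi vi' !sperm_val //=.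
by split_ifs; lia.
Qed.

(** Applying s_i to both entries keeps the order of every pair except (i-1, i). It therefore maps
    the inversions of w bijectively to those of the product other than that pair, and the pair
    itself is the new inversion. *)
Lemma len_asc w i : letter i -> ~~ descent w i -> len (s i * w)%g = (len w).+1.
Proof.
move=> li; rewrite descN // => hw.
pose f (p : 'I_n.+1 * 'I_n.+1) := (s i p.1, s i p.2).
have fK : involutive f.
  by case=> x y; rewrite /f /= -!permM spermK !perm1.
pose p0 : 'I_n.+1 * 'I_n.+1 := (inord i.-1, inord i).
pose A := [set p : 'I_n.+1 * 'I_n.+1 | (p.1 < p.2)%N && (w p.2 < w p.1)%N].
have vi : val (inord i : 'I_n.+1) = i by rewrite /= inordK //; lia.
have vi' : val (inord i.-1 : 'I_n.+1) = i.-1 by rewrite /= inordK //; lia.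
have fp0 : f p0 = (p0.2, p0.1).
  rewrite /f /p0 /= !sperm_inord ?eqxx //; try lia.
  by rewrite ifN //; lia.
have mono x y := @sperm_mono i x y li.
suff -> : len (s i * w)%g = #|p0 |: f @: A|.
  rewrite cardsU1 card_imset; last exact: inv_inj fK.
  suff -> : p0 \notin f @: A by [].
  apply/imsetP => -[p pA e]; have := fK p; rewrite -e fp0 => e'.
  by move: pA; rewrite inE -e' /= /p0 /= vi vi'; lia.
rewrite /len; apply: eq_card => -[x y]; rewrite !inE /= !permM.
case: (altP ((x, y) =P p0)) => [[-> ->]|ne] /=.
  move/(congr1 fst): (fp0) => /= ->; move/(congr1 snd): (fp0) => /= ->.
  by rewrite vi vi' hw andbT; lia.
rewrite -[(x, y)]fK mem_imset; last exact: inv_inj fK.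
rewrite inE /f /=.
case: (altP ((s i x, s i y) =P p0)) => [e|ne'].
  have : (x, y) = (p0.2, p0.1) by rewrite -fp0 -e -/(f (x, y)) fK.
  by case: e => -> -> [-> ->]; rewrite vi vi' [(w _ < _)%N in RHS]ltnNge (ltnW hw); lia.
congr (_ && _); apply/idP/idP => [xy|xy]; first exact: mono.
by have := mono _ _ xy ne'; rewrite -!permM spermK !perm1.
Qed.

Lemma len_desc w i : letter i -> descent w i -> len w = (len (s i * w)%g).+1.
Proof.
by move=> li dw; rewrite -(len_asc li) ?desc_sperm ?negbK // spermKl.
Qed.

Lemma len1 : len (1%g : 'S_n.+1) = 0%N.
Proof.
apply/eqP; rewrite cards_eq0; apply/eqP/setP => p; rewrite !inE !perm1.
by apply/negP; lia.
Qed.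

Lemma lenV w : len (w^-1)%g = len w.
Proof.
pose f (p : 'I_n.+1 * 'I_n.+1) := (w p.2, w p.1).
have fI : injective f by case=> x y [x' y'] [/perm_inj -> /perm_inj ->].
rewrite /len -[RHS](card_imset _ fI); apply: eq_card => -[x y]; rewrite !inE /=.
apply/andP/imsetP => [[xy wxy]|[[x' y']]].
  by exists ((w^-1)%g y, (w^-1)%g x); rewrite ?inE /f /= ?permKV ?wxy.
by rewrite inE /= => /andP[h1 h2] [-> ->]; rewrite !permK.
Qed.

Lemma len_gt0_desc w : (0 < len w)%N -> exists2 i, letter i & descent w i.
Proof.
case: (boolP [exists i : 'I_n.+1, (0 < i)%N && descent w i]).
  by case/existsP=> i /andP[i0 di]; exists (val i) => //; rewrite i0 ltn_ord.
rewrite negb_exists => /forallP h.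
have mono k : forall j, (j < k < n.+1)%N -> (w (inord j) < w (inord k))%N.
  elim: k => [|k IH] j jk; first by lia.
  have lk : letter k.+1 by lia.
  have := h (inord k.+1); rewrite /= inordK; last by lia.
  rewrite /= descN //= => hk.
  have [->//|jk'] := eqVneq j k.
  by apply: ltn_trans hk; apply: IH; lia.
rewrite /len card_gt0 => /set0Pn[[x y]]; rewrite inE /= => /andP[xy].
have := mono y x; rewrite !inord_val xy ltn_ord => /(_ isT); lia.
Qed.

Lemma len0_eq1 w : len w = 0%N -> w = 1%g.
Proof.
move=> l0.
have mono (x y : 'I_n.+1) : (x < y)%N -> (w x < w y)%N.
  move=> xy; rewrite ltnNge leq_eqVlt; apply/negP => /orP[/eqP/val_inj/perm_inj e|h].
    by rewrite e ltnn in xy.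
  have : (x, y) \in [set p : 'I_n.+1 * 'I_n.+1 | (p.1 < p.2)%N && (w p.2 < w p.1)%N].
    by rewrite inE /= xy h.
  by move/eqP: l0; rewrite /len cards_eq0 => /eqP ->; rewrite inE.
have up k (kn : (k < n.+1)%N) : (k <= w (Ordinal kn))%N.
  elim: k kn => // k IH kn; have kn' : (k < n.+1)%N by lia.
  by apply: leq_ltn_trans (IH kn') _; apply: mono; rewrite /= ltnSn.
have dn k : forall kn : (n - k < n.+1)%N, (k <= n)%N ->
    (w (Ordinal kn) <= n - k)%N.
  elim: k => [|k IH] kn kl; first by have := ltn_ord (w (Ordinal kn)); lia.
  have kn' : (n - k < n.+1)%N by lia.
  have := IH kn' (ltnW kl); have : (w (Ordinal kn) < w (Ordinal kn'))%N.
    by apply: mono => /=; lia.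
  by lia.
apply/permP => x; apply: val_inj; rewrite perm1 /=; apply/eqP; rewrite eqn_leq.
have hx : (n - (n - x) < n.+1)%N by have := ltn_ord x; lia.
have e : Ordinal hx = x by apply: val_inj => /=; have := ltn_ord x; lia.
have := dn (n - x)%N hx (leq_subr _ _); rewrite e.
have := up x (ltn_ord x); have -> : Ordinal (ltn_ord x) = x by apply: val_inj.
by have := ltn_ord x; lia.
Qed.

Lemma wp_rcons a i : wp (rcons a i) = (s i * wp a)%g.
Proof. by elim: a => [|j a IH] /=; rewrite ?mulg1 ?mul1g // IH mulgA. Qed.

Lemma wp_cat a b : wp (a ++ b) = (wp b * wp a)%g.
Proof. by elim: a => [|j a IH] /=; rewrite ?mulg1 // IH mulgA. Qed.

Lemma wp_rev a : wp (rev a) = ((wp a)^-1)%g.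
Proof.
elim: a => [|j a IH] /=; first by rewrite invg1.
rewrite rev_cons wp_rcons IH invMg; congr (_ * _)%g.
by apply/eqP; rewrite eq_sym eq_invg_mul spermK.
Qed.

Lemma len_step w i : letter i -> (len (s i * w)%g <= (len w).+1)%N.
Proof.
move=> li; case: (boolP (descent w i)) => h; last by rewrite len_asc.
by have := len_desc li h; lia.
Qed.

Definition letters a := all (fun i => letter i) a.

Lemma letters_rcons a i : letters (rcons a i) = letter i && letters a.
Proof. exact: all_rcons. Qed.

Lemma len_wp a : letters a -> (len (wp a) <= size a)%N.
Proof.
elim/last_ind: a => [|a i IH]; first by rewrite len1.
rewrite letters_rcons => /andP[li la]; rewrite wp_rcons size_rcons.
by apply: leq_trans (len_step _ li) _; rewrite ltnS IH.
Qed.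

Definition reduced w a := [&& letters a, wp a == w & size a == len w].

Lemma red_ex w : exists a, reduced w a.
Proof.
have [m] := ubnP (len w); elim: m w => // m IH w; rewrite ltnS => lw.
have [w0|] := posnP (len w).
  by exists [::]; rewrite /reduced /= w0 (len0_eq1 w0) !eqxx.
case/len_gt0_desc => i li di.
have hl := len_desc li di.
have [|a /and3P[la /eqP wa /eqP sa]] := IH (s i * w)%g; first by lia.
exists (rcons a i); apply/and3P; split.
- by rewrite letters_rcons li la.
- by rewrite wp_rcons wa spermKl.
- by rewrite size_rcons sa hl.
Qed.

Lemma red_rcons w a i : reduced w (rcons a i) = [&& letter i, descent w i & reduced (s i * w)%g a].
Proof.
rewrite /reduced letters_rcons wp_rcons size_rcons -andbA.
apply: andb_id2l => li.
have -> : ((s i * wp a)%g == w) = (wp a == (s i * w)%g).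
  by rewrite -[RHS](inj_eq (mulgI (s i))) spermKl.
case: (boolP (letters a)) => la /=; last by rewrite andbF.
case: eqP => [wa|]; last by rewrite andbF.
case: (boolP (descent w i)) => [/(len_desc li)->|/(len_asc li) h] /=.
  by rewrite eqSS.
by apply/negP => /eqP sa; have := len_wp la; rewrite wa h; lia.
Qed.

Lemma mem_words m l a : (a \in words m l) = (size a == l) && all (fun i => i \in iota 1 m.-1) a.
Proof.
elim: l a => [|l IH] [|i a] //=.
- by apply/negP => /allpairsPdep [i [b [_ _]]].
- apply/allpairsPdep/idP => [[j [b [hj hb [-> ->]]]]|].
    by move: hb; rewrite IH hj => /andP[/eqP -> ->]; rewrite eqxx.
  case/and3P=> sa hi ha; exists i, a; split => //.
  by rewrite IH -eqSS sa ha.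
Qed.

Lemma letter_iota i : (i \in iota 1 n.+1.-1) = letter i.
Proof. by rewrite mem_iota /= add1n. Qed.

Lemma mem_Red w a : (a \in Red w) = reduced w a.
Proof.
rewrite mem_filter mem_words /reduced /letters.
rewrite (eq_all letter_iota).
by case: (all _ _) => /=; rewrite ?andbF // andbT.
Qed.

Lemma head_Red w : reduced w (head [::] (Red w)).
Proof.
rewrite -mem_Red; case: (red_ex w) => a; rewrite -mem_Red.
by case: (Red w) => //= b l _; rewrite inE eqxx.
Qed.

(** Induction on the length, comparing last letters i <= j. Both are descents of w, so some word c
    can be completed to reduced words of w ending in i and in j, by two letters if i and j commute
    and by three if they are adjacent. The induction hypothesis leads from a and b to these
    completions, and one relation exchanges them. *)
Lemma matsumoto (T : Type) (op : nat -> T -> T) :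
  (forall i j g, letter i -> letter j -> (i.+1 < j)%N ->
     op i (op j g) = op j (op i g)) ->
  (forall i g, letter i -> letter i.+1 ->
     op i (op i.+1 (op i g)) = op i.+1 (op i (op i.+1 g))) ->
  forall w a b g, reduced w a -> reduced w b -> foldr op g a = foldr op g b.
Proof.
move=> comm braid w a b g; have [m] := ubnP (len w).
elim: m w a b g => // m IH w a b g; rewrite ltnS => lw.
case/lastP: a => [|a i]; case/lastP: b => [|b j].
- by [].
- by case/and3P=> _ _ /eqP e /and3P[_ _]; rewrite -e size_rcons.
- by case/and3P=> _ _ /eqP e /and3P[_ _]; rewrite -e size_rcons.
move=> ra rb; move: (ra) (rb); rewrite !red_rcons.
case/and3P=> li di ha /and3P[lj dj hb]; rewrite !foldr_rcons.
wlog ij : a b i j ra rb li di ha lj dj hb / (i <= j)%N.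
  move=> H; case: (leqP i j) => ij; first exact: H.
  by symmetry; apply: H => //; exact: ltnW.
have hi := len_desc li di; have hj := len_desc lj dj.
move: ij; rewrite leq_eqVlt => /orP[/eqP e|ij].
  by subst j; apply: IH ha hb; rewrite -hi.
case: (ltnP i.+1 j) => ij'.
  have dj' : descent (s i * w)%g j by rewrite /descent !permM !sperm_fix //; clear -li lj ij'; lia.
  have di' : descent (s j * w)%g i by rewrite /descent !permM !sperm_fix //; clear -li lj ij'; lia.
  case: (red_ex (s j * (s i * w))%g) => c rc.
  have r1 : reduced (s i * w)%g (rcons c j) by rewrite red_rcons lj dj' rc.
  have r2 : reduced (s j * w)%g (rcons c i).
    by rewrite red_rcons li di' mulgA sperm_comm // -mulgA rc.
  rewrite (IH _ _ _ _ _ ha r1); last by rewrite -hi.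
  rewrite (IH _ _ _ _ _ hb r2); last by rewrite -hj.
  by rewrite !foldr_rcons (comm i j g).
have e : j = i.+1 by apply/eqP; rewrite eqn_leq ij' ij.
subst j.
have gi : (w (inord i.+1) < w (inord i.-1))%N by exact: ltn_trans dj di.
have el := sperm_l li; have er := sperm_r li.
have fl := sperm_l lj; have fr := sperm_r lj; rewrite /= in fl fr.
have ef : s i (inord i.+1) = inord i.+1 by apply: sperm_fix; clear -li lj; lia.
have ff : s i.+1 (inord i.-1) = inord i.-1 by apply: sperm_fix; clear -li lj; lia.
have d1 : descent (s i * w)%g i.+1 by rewrite /descent !permM /= ef er.
have d2 : descent (s i.+1 * (s i * w))%g i.
  by rewrite /descent !permM fl ff ef el.
have d3 : descent (s i.+1 * w)%g i by rewrite /descent !permM fl ff.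
have d4 : descent (s i * (s i.+1 * w))%g i.+1.
  by rewrite /descent !permM /= ef er fr ff.
case: (red_ex (s i * (s i.+1 * (s i * w)))%g) => c rc.
have r1 : reduced (s i * w)%g (rcons (rcons c i) i.+1).
  by rewrite red_rcons lj d1 red_rcons li d2 rc.
have r2 : reduced (s i.+1 * w)%g (rcons (rcons c i.+1) i).
  rewrite red_rcons li d3 red_rcons lj d4 /=.
  by rewrite !mulgA -(mulgA (s i.+1)) -sperm_braid // -!mulgA rc.
rewrite (IH _ _ _ _ _ ha r1); last by rewrite -hi.
rewrite (IH _ _ _ _ _ hb r2); last by rewrite -hj.
by rewrite !foldr_rcons (braid i g).
Qed.

Lemma red_letters w a : reduced w a -> letters a.
Proof. by case/and3P. Qed.

Lemma red_wp w a : reduced w a -> wp a = w.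
Proof. by case/and3P=> _ /eqP. Qed.

Lemma red_size w a : reduced w a -> size a = len w.
Proof. by case/and3P=> _ _ /eqP. Qed.

Lemma len_mul_asc w i : letter i -> ~~ descent (w^-1)%g i ->
  len (w * s i)%g = (len w).+1.
Proof.
move=> li h; rewrite -lenV invMg -[RHS]/((len w).+1) -(lenV w).
have -> : ((s i)^-1)%g = s i by apply/eqP; rewrite eq_invg_mul spermK.
exact: len_asc.
Qed.

Lemma red_cons w a i : letter i -> ~~ descent (w^-1)%g i -> reduced w a ->
  reduced (w * s i)%g (i :: a).
Proof.
move=> li h /and3P[la /eqP wa /eqP sa]; rewrite /reduced /= li la wa eqxx /=.
by rewrite len_mul_asc // sa eqxx.
Qed.

(** At the shortest nonreduced suffix [i :: a], the word a is reduced but i is already a left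
    descent. By [matsumoto] a may be replaced by a reduced word starting with i, and [op i] is
    applied twice. *)
Lemma foldr_nonred (T : Type) (op : nat -> T -> T) (z : T) :
  (forall i j g, letter i -> letter j -> (i.+1 < j)%N ->
     op i (op j g) = op j (op i g)) ->
  (forall i g, letter i -> letter i.+1 ->
     op i (op i.+1 (op i g)) = op i.+1 (op i (op i.+1 g))) ->
  (forall i g, letter i -> op i (op i g) = z) ->
  (forall i, letter i -> op i z = z) ->
  forall a g, letters a -> ~~ reduced (wp a) a -> foldr op g a = z.
Proof.
move=> comm braid nil opz; elim=> [|i a IH] g; first by rewrite /reduced /= len1 !eqxx.
case/andP=> li la; case: (boolP (reduced (wp a) a)) => ra; last first.
  by move=> _; rewrite /= IH // opz.
case: (boolP (descent (wp a)^-1%g i)) => [di _ /=|h]; last first.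
  by move/negP; case; apply: red_cons.
case: (red_ex (wp a * s i)%g) => c rc.
have e : ((s i)^-1)%g = s i by apply/eqP; rewrite eq_invg_mul spermK.
have r : reduced (wp a) (i :: c).
  rewrite -[wp a]mulg1 -(spermK i) mulgA; apply: red_cons => //.
  by rewrite invMg e desc_sperm // negbK.
by rewrite (matsumoto comm braid g ra r) /= nil.
Qed.

(** A word is read from its last letter; a letter that is not a descent leads to the absorbing state
    [None]. In this form reducedness is an instance of the abstract [step] of the word sums. *)
Definition red_step i (t : option 'S_n.+1) : option 'S_n.+1 :=
  if t is Some w then if descent w i then Some (s i * w)%g else None else None.

Lemma foldr_red_step w a : letters a ->
  (foldr red_step (Some w) a == Some 1%g) = reduced w a.
Proof.
elim/last_ind: a w => [|a i IH] w.
  move=> _; rewrite /reduced /=; apply/eqP/andP => [[->]|[/eqP <- _]] //.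
  by rewrite len1 !eqxx.
rewrite letters_rcons => /andP[li la]; rewrite foldr_rcons red_rcons li /=.
case: (descent w i) => /=; first exact: IH.
suff -> : foldr red_step None a = None by [].
by elim: a {la IH} => //= j a ->.
Qed.

Lemma red_step_comm i j t : letter i -> letter j -> (i.+1 < j)%N ->
  red_step i (red_step j t) = red_step j (red_step i t).
Proof.
move=> li lj ij; case: t => //= w.
have e1 : descent (s i * w)%g j = descent w j.
  by rewrite /descent !permM !sperm_fix //; lia.
have e2 : descent (s j * w)%g i = descent w i.
  by rewrite /descent !permM !sperm_fix //; lia.
case di: (descent w i); case dj: (descent w j); rewrite /= ?e1 ?e2 ?di ?dj //.
by rewrite !mulgA sperm_comm.
Qed.

Lemma red_step2 i t : letter i -> red_step i (red_step i t) = None.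
Proof.
by move=> li; case: t => //= w; case: (boolP (descent w i)) => //= d; rewrite desc_sperm // d.
Qed.

(** Membership in the Young subgroup S_m x S_(n+1-m). For a letter m it means that m occurs in no
    reduced word of w; see [stab_red] and [notin_stab]. *)
Definition stab m w := forall k, (k < m)%N -> (w (inord k) < m)%N.

Lemma stab1 m : (m <= n.+1)%N -> stab m 1%g.
Proof. by move=> mn k km; rewrite perm1 inordK //; lia. Qed.

Lemma stab_sperm m i w : (m <= n)%N -> letter i -> i != m -> stab m w -> stab m (s i * w)%g.
Proof.
move=> mn li im sw k km; rewrite permM sperm_inord //; last by lia.
by apply: sw; split_ifs; lia.
Qed.

Lemma stab_ge m w k : stab m w -> (m <= k < n.+1)%N -> (m <= w (inord k))%N.
Proof.
move=> sw /andP[mk kn]; rewrite leqNgt; apply/negP => wk.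
pose A := [set x : 'I_n.+1 | (x < m)%N].
have sA : w @: A \subset A.
  by apply/subsetP => _ /imsetP[x + ->]; rewrite !inE -{2}[x]inord_val; apply: sw.
have eA : w @: A = A.
  by apply/eqP; rewrite eqEcard sA (card_imset _ (@perm_inj _ w)) leqnn.
have : w (inord k) \in w @: A by rewrite eA inE.
by rewrite (mem_imset _ _ (@perm_inj _ w)) inE inordK //; lia.
Qed.

Lemma stab_desc m i w : letter m -> letter i -> stab m w -> descent w i -> i != m.
Proof.
move=> lm li sw; apply: contraTneq => ->; rewrite /descent -leqNgt.
have h1 := sw m.-1; have := stab_ge (k := m) sw; lia.
Qed.

Lemma stab_red m w a : letter m -> stab m w -> reduced w a -> m \notin a.
Proof.
move=> lm; elim/last_ind: a w => [|a i IH] w sw //.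
rewrite red_rcons => /and3P[li di ra].
have im := stab_desc lm li sw di.
rewrite mem_rcons inE negb_or eq_sym im; apply: IH ra.
by apply: stab_sperm => //; lia.
Qed.

Lemma notin_stab m a : letter m -> letters a -> m \notin a -> stab m (wp a).
Proof.
move=> lm; elim/last_ind: a => [|a i IH]; first by move=> _ _; apply: stab1; lia.
rewrite letters_rcons mem_rcons inE negb_or => /andP[li la] /andP[im ma].
rewrite wp_rcons; apply: stab_sperm => //; first by lia.
  by rewrite eq_sym.
exact: IH.
Qed.

(** The product [(w * w0 n.+1)%g] reverses the values of w, so each pair of positions is an
    inversion of exactly one of the two. *)
Lemma len_max w : (len (w * w0 n.+1)%g + len w = 'C(n.+1, 2))%N.
Proof.
pose A := [set p : 'I_n.+1 * 'I_n.+1 | (p.1 < p.2)%N].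
pose B := [set p : 'I_n.+1 * 'I_n.+1 | (w p.2 < w p.1)%N].
have <- : #|A| = 'C(n.+1, 2).
  rewrite -bin2_sum big_mkord -sum1_card.
  rewrite (eq_bigl (fun p : 'I_n.+1 * 'I_n.+1 => true && (p.1 < p.2)%N)); last first.
    by move=> p; rewrite inE.
  rewrite (eq_bigr (fun p => (fun=> fun=> 1%N) p.1 p.2)) //.
  rewrite -(pair_big_dep (fun=> true) (fun i j : 'I_n.+1 => (i < j)%N) (fun=> fun=> 1%N)) /=.
  rewrite (exchange_big_dep predT) //=; apply: eq_bigr => j _.
  transitivity (\sum_(i < n.+1) (i < j))%N.
    by rewrite big_mkcond; apply: eq_bigr => i _; case: ifP.
  by rewrite sum_ltn_minn; have := ltn_ord j; lia.
rewrite -(cardsID B A) addnC; congr (_ + _)%N; apply: eq_card => p; rewrite !inE //=.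
rewrite andbC; case: (ltnP p.1 p.2) => //= pp; rewrite ?andbF //= ?andbT.
rewrite !permM !permE /= -leqNgt; have h : w p.1 != w p.2 :> nat.
  by apply/negP => /eqP/val_inj/perm_inj e; rewrite e ltnn in pp.
move: (ltn_ord (w p.1)) (ltn_ord (w p.2)) h.
by move: (nat_of_ord (w p.1)) (nat_of_ord (w p.2)) => x y; lia.
Qed.

Lemma len_max_w0 w : len w = 'C(n.+1, 2) -> w = w0 n.+1.
Proof.
move=> lw; have := len_max w; rewrite lw -[RHS]add0n => /addIn/len0_eq1.
have w0K : (w0 n.+1 * w0 n.+1)%g = 1%g.
  by apply/permP => x; rewrite permM !permE rev_ordK.
by move=> h; rewrite -[LHS]mulg1 -w0K mulgA h mul1g.
Qed.

End Permutations.

(* Decomposing along the value at 0 gives the factors 1 + q + ... + q^i. *)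
Lemma sum_len (F : fieldType) (q : F) n :
  (\sum_(w : 'S_n) q ^+ len w) * (1 - q) ^+ n = \prod_(1 <= i < n.+1) (1 - q ^+ i).
Proof.
have lenE m (w : 'S_m) : len w = (\sum_(x : 'I_m) \sum_(y : 'I_m) ((x < y) && (w y < w x)))%N.
  rewrite /len -sum1_card (eq_bigl (fun p : 'I_m * 'I_m => (p.1 < p.2)%N && (w p.2 < w p.1)%N)); last first.
    by move=> p; rewrite inE.
  rewrite big_mkcond /= pair_bigA /=; apply: eq_bigr => p _.
  by case: (_ && _).
elim: n => [|n IH].
  rewrite expr0 mulr1 big_geq // (bigD1 1%g) //= big1 ?addr0 => [|w].
    by rewrite lenE big_ord0 expr0.
  by case/eqP; apply/permP; case.
pose h (p : 'I_n.+1 * 'S_n) := lift_perm ord0 p.1 p.2.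
have hI : injective h.
  move=> [j u] [k v] /permP e; move: (e ord0); rewrite /h /= !lift_perm_id => ejk.
  rewrite ejk; congr (_, _); apply/permP => x; apply: (@lift_inj _ k).
  by have := e (lift ord0 x); rewrite /h /= !lift_perm_lift ejk.
have hB : bijective h.
  apply: inj_card_bij => //.
  by rewrite card_prod !card_Sn card_ord factS.
have hl j (u : 'S_n) : len (h (j, u)) = (j + len u)%N.
  rewrite !lenE big_ord_recl; congr (_ + _)%N.
    rewrite big_ord_recl /= add0n /h /= lift_perm_id.
    rewrite (reindex_perm u^-1%g) /=.
    under eq_bigr => x _ do rewrite lift_perm_lift permKV.
    transitivity (minn n j); last by apply/minn_idPr; rewrite -ltnS.
    rewrite -sum_ltn_minn; apply: eq_bigr => x _; congr nat_of_bool.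
    by rewrite /= /bump; lia.
  apply: eq_bigr => x _; rewrite big_ord_recl /= add0n.
  apply: eq_bigr => y _; rewrite /h /= !lift_perm_lift.
  congr (nat_of_bool (_ && _)).
  by rewrite /= /bump; lia.
rewrite (reindex h) /=; last exact: onW_bij.
have e p : q ^+ len (h p) = q ^+ p.1 * q ^+ len p.2 by case: p => j u; rewrite hl exprD.
under eq_bigr => p _ do rewrite e.
rewrite -(pair_bigA _ (fun (j : 'I_n.+1) (u : 'S_n) => q ^+ j * q ^+ len u)) /=.
rewrite -big_distrlr /= big_nat_recr //= -IH exprS mulrACA [RHS]mulrC; congr (_ * _).
rewrite mulrC -[X in X - q ^+ _](expr1n F n.+1) subrXX; congr (_ * _).
by apply: eq_bigr => i _; rewrite expr1n mul1r.
Qed.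

(** * Sums over words weighted by comaj *)

Fixpoint wordsL (L : seq nat) k : seq (seq nat) :=
  if k is k'.+1 then [seq i :: a | i <- L, a <- wordsL L k'] else [:: [::]].

Lemma wordsE m k : words m k = wordsL (iota 1 m.-1) k.
Proof. by elim: k => //= k ->. Qed.

Lemma big_wordsL_rcons (F : nmodType) L k (h : seq nat -> F) :
  \sum_(a <- wordsL L k.+1) h a = \sum_(i <- L) \sum_(a <- wordsL L k) h (rcons a i).
Proof.
elim: k h => [|k IH] h.
  by rewrite big_allpairs_dep; apply: eq_bigr => i _; rewrite !big_seq1.
rewrite [LHS]big_allpairs_dep /=; under eq_bigr => i _ do rewrite (IH (fun a => h (i :: a))).
rewrite exchange_big; apply: eq_bigr => j _ /=.
by rewrite big_allpairs_dep.
Qed.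

Lemma mem_wordsL L k a : (a \in wordsL L k) = (size a == k) && all (mem L) a.
Proof.
elim: k a => [|k IH] [|i a] //=.
- by apply/negP => /allpairsPdep [i [b [_ _]]].
- apply/allpairsPdep/idP => [[j [b [hj hb [-> ->]]]]|].
    by move: hb; rewrite IH hj => /andP[/eqP -> ->]; rewrite eqxx.
  case/and3P=> sa hi ha; exists i, a; split => //.
  by rewrite IH -eqSS sa ha.
Qed.

Lemma wordsL_uniq L k : uniq L -> uniq (wordsL L k).
Proof.
move=> uL; elim: k => //= k IH; apply: allpairs_uniq_dep => //.
by case=> i a [j b] _ _ /= [-> ->].
Qed.

(** The relation is arbitrary because renaming letters turns the usual order into another order on
    the same words. *)
Definition comajr (r : rel nat) (a : seq nat) : nat :=
  (\sum_(j < (size a).-1) (if r (nth 0 a j) (nth 0 a j.+1) then j.+1 else 0))%N.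

Lemma comajr_rcons r a j i :
  comajr r (rcons (rcons a j) i) =
    (comajr r (rcons a j) + (if r j i then (size a).+1 else 0))%N.
Proof.
rewrite /comajr !size_rcons /= big_ord_recr /=; congr (_ + _)%N.
  apply: eq_bigr => k _; have hk := ltn_ord k.
  have h1 : (k < (size a).+1)%N by lia.
  have h2 : (k.+1 < (size a).+1)%N by lia.
  by rewrite 2!(nth_rcons _ (rcons a j)) size_rcons h1 h2.
by rewrite nth_rcons size_rcons ltnS leqnn nth_rcons ltnn eqxx nth_rcons size_rcons ltnn eqxx.
Qed.

Lemma comajr_map (f : nat -> nat) a :
  comaj (map f a) = comajr (fun i j => f i < f j)%N a.
Proof.
rewrite /comaj /comajr size_map; apply: eq_bigr => j _.
by rewrite !(nth_map 0%N) //; have := ltn_ord j; lia.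
Qed.

Section WordSums.
Variables (F : fieldType) (q : F) (T : Type) (step : nat -> T -> T) (val : T -> F).
Variables (dead : T) (y : nat -> F).
Hypothesis q_gen : forall m, (0 < m)%N -> 1 - q ^+ m != 0.

Section Alphabet.
Variables (L : seq nat) (r : rel nat).

(* Words of length [l.+1] whose last letter is [i]. *)
Fixpoint lastsum l i t : F :=
  if l is l'.+1 then
    y i * \sum_(j <- L) (if r j i then q ^+ l else 1) * lastsum l' j (step i t)
  else y i * val (step i t).

(** The letters act on the state t from the last one on, and [val] reads off the final state. Taking
    divided differences as [step] gives the expansion of phi; taking [red_step] counts reduced
    words. *)
Definition wordsum l t : F :=
  \sum_(a <- wordsL L l) q ^+ comajr r a * (\prod_(i <- a) y i) * val (foldr step t a).

Lemma lastsumE l i t : lastsum l i t =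
  \sum_(a <- wordsL L l) q ^+ comajr r (rcons a i) * (\prod_(k <- rcons a i) y k)
     * val (foldr step t (rcons a i)).
Proof.
elim: l i t => [|l IH] i t.
  by rewrite big_seq1 /= /comajr big_ord0 expr0 mul1r big_seq1.
rewrite big_wordsL_rcons /= big_distrr; apply: eq_bigr => j _ /=.
rewrite IH !big_distrr /= big_seq [RHS]big_seq; apply: eq_bigr => a.
rewrite mem_wordsL => /andP[/eqP sa _].
rewrite comajr_rcons sa exprD !foldr_rcons [in RHS]big_rcons /=.
by case: ifP => _; rewrite ?expr0; ring.
Qed.

Lemma wordsumS l t : wordsum l.+1 t = \sum_(i <- L) lastsum l i t.
Proof. by rewrite /wordsum big_wordsL_rcons; apply: eq_bigr => i _; rewrite lastsumE. Qed.

Lemma wordsum0 t : wordsum 0 t = val t.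
Proof. by rewrite /wordsum big_seq1 big_nil /comajr big_ord0 expr0 !mul1r. Qed.

(** This is 1 / [l]_q!, written with the denominators 1 - q^i that are known to be nonzero. *)
Definition qfact_inv l : F := (1 - q) ^+ l / \prod_(1 <= i < l.+1) (1 - q ^+ i).

Lemma qfact_inv0 : qfact_inv 0 = 1.
Proof. by rewrite /qfact_inv big_geq // divr1. Qed.

Lemma qfact_invS l : (1 - q ^+ l.+1) * qfact_inv l.+1 = (1 - q) * qfact_inv l.
Proof.
rewrite /qfact_inv big_nat_recr //= [(1 - q) ^+ l.+1]exprS invfM.
set P := \prod_(_ <= _ < _) _; have := q_gen (ltn0Sn l).
move: (1 - q ^+ l.+1) => u u0.
move: (1 - q) ((1 - q) ^+ l) (P^-1) => a b c.
transitivity (a * (b * c) * (u / u)); first by ring.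
by rewrite divff ?mulr1.
Qed.

Definition nwordsum l t := qfact_inv l * wordsum l t.

(* Sums over the strictly decreasing subwords of [s]; applied to [q ^+ d * f], which
   is f(qx) for f homogeneous of degree d, this is the q-Taylor expansion of f. *)
Fixpoint descsum (B : nat -> T -> F) l (s : seq nat) t : F :=
  if s is i :: s' then
    descsum B l s' t + (if l is l'.+1 then (1 - q) * y i * descsum B l' s' (step i t) else 0)
  else B l t.

Hypothesis step_dead : forall i, i \in L -> step i dead = dead.
Hypothesis val_dead : val dead = 0.
Hypothesis step2 : forall i t, i \in L -> step i (step i t) = dead.
Hypothesis rL : pairwise (fun i j => r i j && ~~ r j i) L.

Lemma lastsum_dead l i : i \in L -> lastsum l i dead = 0.
Proof.
elim: l i => [|l IH] i iL /=; first by rewrite step_dead // val_dead mulr0.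
by rewrite big_seq big1 ?mulr0 // => j jL; rewrite step_dead // IH // mulr0.
Qed.

Lemma lastsum2 l i t : i \in L -> lastsum l i (step i t) = 0.
Proof.
case: l => [|l] iL /=; first by rewrite step2 // val_dead mulr0.
by rewrite big_seq big1 ?mulr0 // => j jL; rewrite step2 // lastsum_dead // mulr0.
Qed.

(** Enlarging s by a letter i raises the weight of the words ending in i from q^l to 1. In the step,
    the part before the last letter i has length l - 1 and carries weight q^(l-1) if it ends in p
    and 1 if it ends in s: exactly the comaj factor of an ascent or a descent there. If it ends in
    i, the state is dead. *)
Lemma descsum_nwordsum_suffix l p s t : L = p ++ s ->
  descsum (fun d u => q ^+ d * nwordsum d u) l s t =
  q ^+ l * nwordsum l t + (1 - q ^+ l) * \sum_(i <- s) qfact_inv l * lastsum l.-1 i t.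
Proof.
elim: s l p t => [|i s IH] l p t eL; first by rewrite big_nil mulr0 addr0.
have eL' : L = rcons p i ++ s by rewrite cat_rcons.
have iL : i \in L by rewrite eL mem_cat mem_head orbT.
rewrite /= (IH l _ _ eL') big_cons mulrDr [in RHS]addrCA [RHS]addrC; congr (_ + _).
case: l => [|l]; first by rewrite expr0 subrr mul0r.
rewrite [RHS]mulrA qfact_invS -[LHS]mulrA -[RHS]mulrA; congr (_ * _).
rewrite (IH l _ _ eL'); case: l => [|l] /=.
  by rewrite expr0 subrr mul0r addr0 mul1r qfact_inv0 mul1r /nwordsum qfact_inv0 mul1r wordsum0.
rewrite /nwordsum wordsumS -big_distrr /= [RHS]mulrCA; congr (_ * _).
rewrite [q ^+ _ * _]mulrCA [(1 - _) * _]mulrCA -mulrDr; congr (_ * _).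
rewrite eL !big_cat !big_cons /= lastsum2 // !mulr0 !add0r.
move: rL; rewrite eL pairwise_cat pairwise_cons => /and3P[/allrelP hp _ /andP[/allP hs _]].
rewrite mulrDr -addrA; congr (_ + _).
  rewrite big_distrr /= big_seq [RHS]big_seq; apply: eq_bigr => j jp.
  by case/andP: (hp j i jp (mem_head _ _)) => ->.
rewrite -mulrDl addrCA subrr addr0 mul1r.
rewrite big_seq [RHS]big_seq; apply: eq_bigr => j js.
by case/andP: (hs j js) => _ /negPf ->; rewrite mul1r.
Qed.

(** The case where s is the whole alphabet: the normalized word sum is a fixed point of the q-Taylor
    expansion. *)
Lemma descsum_nwordsum l t :
  descsum (fun d u => q ^+ d * nwordsum d u) l L t = nwordsum l t.
Proof.
rewrite (@descsum_nwordsum_suffix _ [::]) //; case: l => [|l].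
  by rewrite expr0 subrr mul0r addr0 mul1r.
by rewrite -big_distrr /= -wordsumS -mulrDl addrCA subrr addr0 mul1r.
Qed.

End Alphabet.

Lemma descsum_insert B l s1 s2 i t :
  (forall j u, j \in s1 -> step i (step j u) = step j (step i u)) ->
  descsum B l (s1 ++ i :: s2) t = descsum B l (i :: s1 ++ s2) t.
Proof.
elim: s1 l t => [|a s1 IH] l t comm //=.
have comm' j u : j \in s1 -> step i (step j u) = step j (step i u).
  by move=> js; apply: comm; rewrite inE js orbT.
rewrite IH //=; case: l => [|l]; first by rewrite !addr0.
rewrite IH //=; case: l => [|l]; rewrite ?comm ?mem_head //; ring.
Qed.

Lemma descsum_swap B l s1 s2 t :
  (forall i j u, i \in s1 -> j \in s2 -> step j (step i u) = step i (step j u)) ->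
  descsum B l (s1 ++ s2) t = descsum B l (s2 ++ s1) t.
Proof.
elim: s2 l t => [|i s2 IH] l t comm; first by rewrite cats0.
rewrite descsum_insert => [|j u js]; last by apply: comm => //; rewrite mem_head.
rewrite /= IH => [|j k u js ks]; last by apply: comm => //; rewrite inE ks orbT.
case: l => [|l] //; rewrite IH // => j k u js ks.
by apply: comm => //; rewrite inE ks orbT.
Qed.

(** A nonempty subword lowers the degree, so the two bases differ only in the term of the empty
    subword. *)
Lemma descsum_base B B' l s t :
  (forall d u, (d < l)%N -> B d u = B' d u) ->
  descsum B l s t - descsum B' l s t = B l t - B' l t.
Proof.
elim: s l t => [|i s IH] l t BB //=.
rewrite opprD addrACA IH //; case: l BB => [|l] BB /=; first by rewrite subrr addr0.
rewrite -mulrBr IH => [|d u dl]; last by apply: BB; lia.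
by rewrite (BB l) // subrr mulr0 addr0.
Qed.

(** Both sums satisfy the same fixed-point identity, since [descsum] does not see the order of two
    commuting blocks. If they agree below degree l, their difference in degree l equals q^l times
    itself, so it is zero for l > 0. *)
Lemma wordsum_swap s1 s2 r1 r2 l t :
  (forall i, i \in s1 ++ s2 -> step i dead = dead) -> val dead = 0 ->
  (forall i u, i \in s1 ++ s2 -> step i (step i u) = dead) ->
  (forall i j u, i \in s1 -> j \in s2 -> step j (step i u) = step i (step j u)) ->
  pairwise (fun i j => r1 i j && ~~ r1 j i) (s1 ++ s2) ->
  pairwise (fun i j => r2 i j && ~~ r2 j i) (s2 ++ s1) ->
  wordsum (s1 ++ s2) r1 l t = wordsum (s2 ++ s1) r2 l t.
Proof.
move=> sd vd s2d comm p1 p2.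
have sw i : (i \in s2 ++ s1) = (i \in s1 ++ s2) by rewrite !mem_cat orbC.
have sd' i : i \in s2 ++ s1 -> step i dead = dead by rewrite sw; apply: sd.
have s2d' i u : i \in s2 ++ s1 -> step i (step i u) = dead by rewrite sw; apply: s2d.
elim/ltn_ind: l t => l IH t.
have IH' d u : (d < l)%N ->
    q ^+ d * nwordsum (s1 ++ s2) r1 d u = q ^+ d * nwordsum (s2 ++ s1) r2 d u.
  by move=> dl; rewrite /nwordsum IH.
have := descsum_base (s2 ++ s1) t IH'.
rewrite -descsum_swap // !descsum_nwordsum // -[RHS]mulrBr => h.
have {}h : (1 - q ^+ l) * (nwordsum (s1 ++ s2) r1 l t - nwordsum (s2 ++ s1) r2 l t) = 0.
  by rewrite mulrBl mul1r {1}h subrr.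
case: l IH IH' h => [|l] IH IH' h; first by rewrite !wordsum0.
move/eqP: h; rewrite mulf_eq0 (negPf (q_gen _)) //= /nwordsum -mulrBr mulf_eq0.
rewrite subr_eq0; case/orP => /eqP // h.
have : qfact_inv l.+1 != 0.
  rewrite mulf_neq0 ?invr_eq0 ?expf_neq0 //.
    by have := @q_gen 1%N isT; rewrite expr1.
  by rewrite prodf_seq_neq0; apply/allP => i; rewrite mem_index_iota => /andP[i0 _]; rewrite q_gen.
by rewrite h eqxx.
Qed.

End WordSums.

(** * The q-divided symmetrization *)

(** Subtraction of m modulo [n.+1], for m at most [n.+1]; the letter m goes to 0. *)
Definition cshift n m a := ((a + (n.+1 - m)) %% n.+1)%N.

(* What is used of the field K (n+1), with n + 1 (not n) variables x_i: its elements
   are never taken apart, so that [field] and [ring] only meet an abstract field. *)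
Record symfield (n : nat) (F : fieldType) := SymField {
  qv : F;
  xv : nat -> F;
  sact : 'S_n.+1 -> {rmorphism F -> F};
  sact1 : forall g, sact 1%g g = g;
  sactM : forall u v g, sact (u * v)%g g = sact v (sact u g);
  sact_x : forall u k, (k < n.+1)%N -> sact u (xv k.+1) = xv (u (inord k)).+1;
  sact_q : forall u, sact u qv = qv;
  x_neq : forall i j, (0 < i <= n.+1)%N -> (0 < j <= n.+1)%N -> i != j ->
    xv i - xv j != 0;
  qx_neq : forall i j, (0 < i <= n.+1)%N -> (0 < j <= n.+1)%N -> i != j ->
    qv * xv i - xv j != 0;
  q_gen : forall m, (0 < m)%N -> 1 - qv ^+ m != 0;
  fact_neq0 : (n.+1)`!%:R != 0 :> F
}.
Arguments sact1 {n F s} g.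
Arguments sactM {n F s} u v g.
Arguments sact_x {n F s} u [k] _.
Arguments sact_q {n F s} u.
Arguments x_neq {n F s} [i j] _ _ _.
Arguments qx_neq {n F s} [i j] _ _ _.
Arguments q_gen {n F s} [m] _.
Arguments fact_neq0 {n F} s.

Section DividedSymmetrization.
Variables (F : fieldType) (n : nat) (S : symfield n F).

Local Notation s := (sperm n.+1).
Local Notation letter i := (0 < i < n.+1)%N.
Local Notation index i := (0 < i <= n.+1)%N.
Local Notation q := (qv S).
Local Notation x := (xv S).
Local Notation ac i := (sact S (s i)).

(** * Divided differences and the operators T_i: commutation and braid relations *)

Definition dd i (g : F) : F := (g - ac i g) / (x i - x i.+1).
Definition Tq i (g : F) : F := (q - 1) * dd i (x i * g) + ac i g.

Lemma ac_ac i g : ac i (ac i g) = g.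
Proof. by rewrite -sactM spermK sact1. Qed.

Lemma ac_x i k : letter i -> index k ->
  ac i (x k) = x (if k == i then i.+1 else if k == i.+1 then i else k).
Proof.
move=> li; case: k => // k kn; rewrite sact_x ?sperm_inord //; try lia.
by congr (x _); split_ifs; rewrite inordK; lia.
Qed.

Lemma ac_xl i : letter i -> ac i (x i) = x i.+1.
Proof. by move=> li; rewrite ac_x ?eqxx //; lia. Qed.

Lemma ac_xr i : letter i -> ac i (x i.+1) = x i.
Proof. by move=> li; rewrite ac_x ?eqxx ?ifN //; lia. Qed.

Lemma ac_xn i k : letter i -> index k -> k != i -> k != i.+1 -> ac i (x k) = x k.
Proof. by move=> li lk h1 h2; rewrite ac_x // !ifN. Qed.

Lemma ac_comm i j g : letter i -> letter j -> (i.+1 < j)%N ->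
  ac i (ac j g) = ac j (ac i g).
Proof. by move=> li lj ij; rewrite -!sactM (@sperm_comm n i j). Qed.

Lemma ac_braid i g : letter i -> letter i.+1 ->
  ac i (ac i.+1 (ac i g)) = ac i.+1 (ac i (ac i.+1 g)).
Proof. by move=> li lj; rewrite -!sactM sperm_braid. Qed.

Definition ac_rw := (rmorphB, rmorphD, rmorphM, rmorph1, fmorphV, @sact_q n F S).

Lemma x_succ i : letter i -> x i - x i.+1 != 0.
Proof. by move=> li; apply: x_neq; lia. Qed.

Lemma TqE i g : letter i ->
  Tq i g = ((q - 1) * x i * g + (x i - q * x i.+1) * ac i g) / (x i - x i.+1).
Proof.
move=> li; rewrite /Tq /dd rmorphM ac_xl //; have := x_succ li.
by move: (ac i g) => h u; field; rewrite u.
Qed.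

Lemma dd_comm i j g : letter i -> letter j -> (i.+1 < j)%N ->
  dd i (dd j g) = dd j (dd i g).
Proof.
move=> li lj ij; rewrite /dd !ac_rw /=.
rewrite (ac_comm g) // !(@ac_xn i) ?(@ac_xn j) //; try lia.
have := x_succ li; have := x_succ lj.
move: (ac j (ac i g)) (ac i g) (ac j g) => a b c h1 h2.
by field; rewrite h1 h2.
Qed.

Lemma Tq_comm i j g : letter i -> letter j -> (i.+1 < j)%N ->
  Tq i (Tq j g) = Tq j (Tq i g).
Proof.
move=> li lj ij; rewrite !TqE // !ac_rw /=.
rewrite (ac_comm g) // !(@ac_xn i) ?(@ac_xn j) //; try lia.
have := x_succ li; have := x_succ lj.
move: (ac j (ac i g)) (ac i g) (ac j g) => a b c h1 h2.
by field; rewrite h1 h2.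
Qed.

Lemma dd_braid i g : letter i -> letter i.+1 ->
  dd i (dd i.+1 (dd i g)) = dd i.+1 (dd i (dd i.+1 g)).
Proof.
move=> li lj; rewrite /dd !ac_rw /=.
have e1 : ac i (x i.+2) = x i.+2 by apply: ac_xn; lia.
have e2 : ac i.+1 (x i) = x i by apply: ac_xn; lia.
rewrite !(ac_xl li, ac_xr li, ac_xl lj, ac_xr lj, e1, e2).
rewrite (ac_braid g) // !ac_ac.
have := x_succ li; have := x_succ lj; have : x i - x i.+2 != 0 by apply: x_neq; lia.
move: (ac i (ac i.+1 g)) (ac i.+1 (ac i g)) (ac i g) (ac i.+1 g) (ac i.+1 (ac i (ac i.+1 g))) => a b c d e.
move: (x i) (x i.+1) (x i.+2) => u v w h1 h2 h3.
have h4 : v - u != 0 by rewrite -opprB oppr_eq0.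
have h5 : w - v != 0 by rewrite -opprB oppr_eq0.
by field; rewrite h1 h2 h3 h4 h5.
Qed.

Lemma Tq_braid i g : letter i -> letter i.+1 ->
  Tq i (Tq i.+1 (Tq i g)) = Tq i.+1 (Tq i (Tq i.+1 g)).
Proof.
move=> li lj; rewrite !TqE // !ac_rw /=.
have e1 : ac i (x i.+2) = x i.+2 by apply: ac_xn; lia.
have e2 : ac i.+1 (x i) = x i by apply: ac_xn; lia.
rewrite !(ac_xl li, ac_xr li, ac_xl lj, ac_xr lj, e1, e2).
rewrite (ac_braid g) // !ac_ac.
have := x_succ li; have := x_succ lj; have : x i - x i.+2 != 0 by apply: x_neq; lia.
move: (ac i (ac i.+1 g)) (ac i.+1 (ac i g)) (ac i g) (ac i.+1 g) (ac i.+1 (ac i (ac i.+1 g))) => a b c d e.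
move: (x i) (x i.+1) (x i.+2) => u v w h1 h2 h3.
have h4 : v - u != 0 by rewrite -opprB oppr_eq0.
have h5 : w - v != 0 by rewrite -opprB oppr_eq0.
by field; rewrite h1 h2 h3 h4 h5.
Qed.

Lemma dd2 i g : letter i -> dd i (dd i g) = 0.
Proof.
move=> li; rewrite /dd !ac_rw /= ac_ac ac_xl ?ac_xr //.
have := x_succ li; move: (ac i g) => h u.
by field; rewrite u -oppr_eq0 opprB u.
Qed.

(** * Symmetrizers, and the sum of all T_w *)

Definition invar (c : F) := forall u, sact S u c = c.

Lemma invarP c : (forall i, letter i -> ac i c = c) -> invar c.
Proof.
move=> h u; case: (red_ex u) => a /and3P[la /eqP <- _].
elim: a la => [|i a IH] /=; first by rewrite sact1.
by case/andP=> li la; rewrite sactM IH ?h.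
Qed.

Definition Sym (g : F) : F := \sum_u sact S u g.

Lemma Sym_act u g : Sym (sact S u g) = Sym g.
Proof.
rewrite /Sym [RHS](reindex_inj (mulgI u)) /=.
by apply: eq_bigr => v _; rewrite sactM.
Qed.

Lemma SymD g h : Sym (g + h) = Sym g + Sym h.
Proof. by rewrite /Sym -big_split; apply: eq_bigr => u _; rewrite rmorphD. Qed.

Lemma SymB g h : Sym (g - h) = Sym g - Sym h.
Proof. by rewrite /Sym -sumrB; apply: eq_bigr => u _; rewrite rmorphB. Qed.

Lemma Sym_sum (I : finType) (f : I -> F) : Sym (\sum_i f i) = \sum_i Sym (f i).
Proof.
by rewrite /Sym [RHS]exchange_big; apply: eq_bigr => u _; rewrite rmorph_sum.
Qed.

Lemma SymZ c g : invar c -> Sym (c * g) = c * Sym g.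
Proof. by move=> hc; rewrite /Sym big_distrr; apply: eq_bigr => u _; rewrite rmorphM hc. Qed.

Definition xo (a : 'I_n.+1) : F := x a.+1.

Lemma act_xo u a : sact S u (xo a) = xo (u a).
Proof. by rewrite /xo sact_x ?inord_val. Qed.

Lemma act_pairprod (P : pred ('I_n.+1 * 'I_n.+1)) (g : 'I_n.+1 -> 'I_n.+1 -> F) i :
  (forall u a b, sact S u (g a b) = g (u a) (u b)) ->
  ac i (\prod_(p | P p) g p.1 p.2) =
  \prod_(p | P (s i p.1, s i p.2)) g p.1 p.2.
Proof.
move=> hg; rewrite rmorph_prod.
pose f (p : 'I_n.+1 * 'I_n.+1) := (s i p.1, s i p.2).
have fI : injective f by case=> a b [c d] [/perm_inj -> /perm_inj ->].
rewrite [RHS](reindex_inj fI); apply: eq_big => [[a b]|[a b] _]; last by rewrite hg.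
by rewrite /= -!permM spermK !perm1.
Qed.

Lemma pair_swap i (a b : 'I_n.+1) : letter i ->
  ((s i a < s i b)%N && ((s i a, s i b) != (inord i.-1, inord i))) =
  ((a < b)%N && ((a, b) != (inord i.-1, inord i))).
Proof.
move=> li.
have key (c d : 'I_n.+1) : (c < d)%N && ((c, d) != (inord i.-1, inord i)) ->
    (s i c < s i d)%N && ((s i c, s i d) != (inord i.-1, inord i)).
  case/andP=> cd ne; rewrite (sperm_mono li cd ne) /=.
  apply/eqP => -[e1 e2].
  have {}e1 : c = inord i by rewrite -[c]perm1 -(spermK n i) permM e1 sperm_l.
  have {}e2 : d = inord i.-1 by rewrite -[d]perm1 -(spermK n i) permM e2 sperm_r.
  by move: cd; rewrite e1 e2 !inordK; lia.
apply/idP/idP => [/key|/key //]; by rewrite -!permM spermK !perm1.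
Qed.

Definition pf (a b : 'I_n.+1) : F := (q * xo a - xo b) / (xo a - xo b).

Lemma act_pf u a b : sact S u (pf a b) = pf (u a) (u b).
Proof. by rewrite /pf !ac_rw /= !act_xo. Qed.

Definition Pi : F := \prod_(p : 'I_n.+1 * 'I_n.+1 | (p.1 < p.2)%N) pf p.1 p.2.

Definition Sc (g : F) : F := Sym (Pi * g).

(** Let p be the factor [pf] of the pair (i-1, i). Then T_i g = p g + s_i (p g) - g and p + s_i p =
    1 + q. The other factors of [Pi] are s_i-invariant as a product, so symmetrizing yields the
    scalar (1 + q) - 1. *)
Lemma Sc_Tq i g : letter i -> Sc (Tq i g) = q * Sc g.
Proof.
move=> li.
pose p0 : 'I_n.+1 * 'I_n.+1 := (inord i.-1, inord i).
pose P' := \prod_(p : 'I_n.+1 * 'I_n.+1 | (p.1 < p.2)%N && (p != p0)) pf p.1 p.2.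
have ePi : Pi = P' * pf p0.1 p0.2.
  by rewrite /Pi (bigD1 p0) /=; [rewrite mulrC|rewrite !inordK; lia].
have hP' : ac i P' = P'.
  rewrite (act_pairprod _ _ act_pf); apply: eq_bigl => -[a b] /=.
  exact: pair_swap.
have x1 : xo p0.1 = x i by rewrite /xo /p0 /=; congr (x _); rewrite inordK; lia.
have x2 : xo p0.2 = x i.+1 by rewrite /xo /p0 /=; congr (x _); rewrite inordK; lia.
have e1 : Tq i g = pf p0.1 p0.2 * g + ac i (pf p0.1 p0.2 * g) - g.
  rewrite TqE // /pf x1 x2 !ac_rw /= ac_xl // ac_xr //.
  have := x_succ li; move: (ac i g) => h h1.
  have h2 : x i.+1 - x i != 0 by rewrite -opprB oppr_eq0.
  by field; rewrite h1 h2.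
have e2 : pf p0.1 p0.2 + ac i (pf p0.1 p0.2) = 1 + q.
  rewrite /pf x1 x2 !ac_rw /= ac_xl // ac_xr //.
  have h1 := x_succ li.
  have h2 : x i.+1 - x i != 0 by rewrite -opprB oppr_eq0.
  by field; rewrite h1 h2.
have invq : invar (1 + q) by move=> u; rewrite !ac_rw.
rewrite /Sc e1 mulrBr SymB mulrDr SymD.
have -> : Sym (Pi * ac i (pf p0.1 p0.2 * g)) = Sym (P' * ac i (pf p0.1 p0.2) * (pf p0.1 p0.2 * g)).
  by rewrite -(Sym_act (s i)) ePi !rmorphM /= !ac_ac hP'.
have e3 : Pi * (pf p0.1 p0.2 * g) + P' * ac i (pf p0.1 p0.2) * (pf p0.1 p0.2 * g) =
    (1 + q) * (Pi * g).
  by rewrite ePi -e2; ring.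
rewrite -SymD e3 SymZ //.
by rewrite mulrDl mul1r addrAC subrr add0r.
Qed.

Definition Tqw (w : 'S_n.+1) g := foldr Tq g (head [::] (Red w)).

Lemma Tqw_red w a g : reduced w a -> Tqw w g = foldr Tq g a.
Proof.
move=> ra; apply: matsumoto (head_Red w) ra => [i j h|i h]; first exact: Tq_comm.
exact: Tq_braid.
Qed.

Lemma Sc_Tqw w g : Sc (Tqw w g) = q ^+ len w * Sc g.
Proof.
have /and3P[] := head_Red w; rewrite /Tqw => + _ /eqP <-.
elim: (head _ _) => [|i a IH] /=; first by rewrite expr0 mul1r.
by case/andP=> li la; rewrite Sc_Tq // IH // mulrA -exprS.
Qed.

Definition Tqall g := \sum_w Tqw w g.

(** Reduced words come in pairs a and [i :: a], which writes the sum as 1 + T_i applied to half of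
    its terms; the image of 1 + T_i is s_i-invariant. *)
Lemma Tqall_inv g : invar (Tqall g).
Proof.
apply: invarP => i li.
have e : ((s i)^-1)%g = s i by apply/eqP; rewrite eq_invg_mul spermK.
have -> : Tqall g = \sum_(w : 'S_n.+1 | ~~ descent (w^-1)%g i) (Tqw w g + Tq i (Tqw w g)).
  rewrite /Tqall (bigID (fun w : 'S_n.+1 => descent (w^-1)%g i)) /= addrC big_split /=.
  congr (_ + _); rewrite (reindex_inj (mulIg (s i))) /=.
  apply: eq_big => [w|w h]; first by rewrite invMg e desc_sperm.
  rewrite (@Tqw_red _ (i :: head [::] (Red w))) //.
  apply: red_cons => //; last exact: head_Red.
  by move: h; rewrite invMg e desc_sperm.
rewrite rmorph_sum; apply: eq_bigr => w _ /=; move: (Tqw w g) => h.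
rewrite TqE // !ac_rw /= ac_xl // ac_xr // ac_ac.
have := x_succ li; move: (ac i h) => h' h1.
have h2 : x i.+1 - x i != 0 by rewrite -opprB oppr_eq0.
by field; rewrite h1 h2.
Qed.

Definition poinc : F := \sum_(w : 'S_n.+1) q ^+ len w.

Lemma poinc_neq0 : poinc != 0.
Proof.
have h : \prod_(1 <= i < n.+2) (1 - q ^+ i) != 0.
  rewrite prodf_seq_neq0; apply/allP => i; rewrite mem_index_iota => /andP[i0 _].
  by rewrite q_gen.
by move: h; rewrite -sum_len mulf_eq0 negb_or => /andP[].
Qed.

(** Two evaluations of [Sc (Tqall g)]: the invariant [Tqall g] comes out of [Sc], and under [Sc]
    each [Tqw w] is the scalar [q ^+ len w]. *)
Lemma Tqall_Sc g : Tqall g * Sc 1 = poinc * Sc g.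
Proof.
transitivity (Sc (Tqall g)).
  by rewrite /Sc mulrC mulr1 [Pi * _]mulrC SymZ //; [rewrite mulrC | exact: Tqall_inv].
rewrite /poinc big_distrl /= /Tqall /Sc big_distrr Sym_sum; apply: eq_bigr => w _.
exact: Sc_Tqw.
Qed.

Lemma pf_neq0 a b : a != b -> pf a b != 0.
Proof.
move=> ab; have ab' : a.+1 != b.+1 by rewrite eqSS.
rewrite /pf mulf_neq0 ?invr_eq0 //; first by apply: qx_neq => //=; exact: ltn_ord.
by apply: x_neq => //=; exact: ltn_ord.
Qed.

Lemma Pi_neq0 : Pi != 0.
Proof.
rewrite prodf_seq_neq0; apply/allP => p _; apply/implyP => h.
by apply: pf_neq0; apply: contraTneq h => ->; rewrite ltnn.
Qed.

(** Tested on [Pi^-1], where [Sc] takes the value (n+1)!: if [Sc 1] were zero, [Tqall_Sc] would give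
    [poinc] times (n+1)! = 0. *)
Lemma Sc1_neq0 : Sc 1 != 0.
Proof.
apply/eqP => h; have := Tqall_Sc Pi^-1.
rewrite h mulr0 /Sc divff ?Pi_neq0 // /Sym.
under eq_bigr => u _ do rewrite rmorph1.
rewrite sumr_const card_Sn => /esym/eqP; rewrite mulf_eq0 (negPf poinc_neq0) /=.
by rewrite (negPf (fact_neq0 S)).
Qed.

(* Both [Sc] and [Tqall] are symmetrizers for the operators [Tq i], so they are
   proportional; this replaces the explicit computation of the sum of all T_w. *)
Lemma TqallE g : Tqall g = (poinc / Sc 1) * Sc g.
Proof.
apply: (mulIf Sc1_neq0); rewrite Tqall_Sc.
by rewrite mulrAC divfK ?Sc1_neq0.
Qed.

(** ** Homogeneous elements and vanishing *)

(** Field elements are not opened, so homogeneous polynomials are generated inductively. The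
    coefficients are arbitrary invariants, all placed in degree 0; this is harmless because [Sym]
    and the divided differences are linear over invariants. *)
Inductive hom : nat -> F -> Prop :=
| hom_inv c of invar c : hom 0 c
| hom_x d i f of index i & hom d f : hom d.+1 (x i * f)
| hom_add d f g of hom d f & hom d g : hom d (f + g)
| hom_zero d : hom d 0.

Lemma invar1 : invar 1.
Proof. by move=> u; rewrite rmorph1. Qed.

Lemma hom1 : hom 0 1.
Proof. exact/hom_inv/invar1. Qed.

Lemma invar_q : invar q.
Proof. by move=> u; rewrite sact_q. Qed.

Lemma invarB c e : invar c -> invar e -> invar (c - e).
Proof. by move=> hc he u; rewrite rmorphB /= hc he. Qed.

Lemma invarM c e : invar c -> invar e -> invar (c * e).
Proof. by move=> hc he u; rewrite rmorphM /= hc he. Qed.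

Lemma invarX c m : invar c -> invar (c ^+ m).
Proof. by move=> hc u; rewrite rmorphXn /= hc. Qed.

Lemma hom_invM d c f : invar c -> hom d f -> hom d (c * f).
Proof.
move=> hc; elim=> {d f} [e he|d i f li hf IH|d f g hf IHf hg IHg|d].
- by apply: hom_inv; apply: invarM.
- by rewrite mulrCA; apply: hom_x.
- by rewrite mulrDr; apply: hom_add.
- by rewrite mulr0; apply: hom_zero.
Qed.

Lemma homN d f : hom d f -> hom d (- f).
Proof. by move=> hf; rewrite -mulN1r; apply: hom_invM => // u; rewrite rmorphN1. Qed.

Lemma homB d f g : hom d f -> hom d g -> hom d (f - g).
Proof. by move=> hf /homN hg; apply: hom_add. Qed.

Lemma homM d e f g : hom d f -> hom e g -> hom (d + e) (f * g).
Proof.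
move=> hf hg; elim: hf => {d f} [c hc|d i f li hf IH|d f g' hf IHf hg' IHg|d].
- exact: hom_invM.
- by rewrite addSn -mulrA; apply: hom_x.
- by rewrite mulrDl; apply: hom_add.
- by rewrite mul0r; apply: hom_zero.
Qed.

Lemma hom_var i : index i -> hom 1 (x i).
Proof. by move=> li; rewrite -[x i]mulr1; apply: hom_x => //; exact: hom1. Qed.

Lemma hom_sum (I : Type) (r : seq I) (P : pred I) f d :
  (forall i, P i -> hom d (f i)) -> hom d (\sum_(i <- r | P i) f i).
Proof. by move=> h; elim/big_ind: _ => //; [exact: hom_zero|exact: hom_add]. Qed.

Lemma hom_prod (I : Type) (r : seq I) (P : pred I) f (d : I -> nat) :
  (forall i, P i -> hom (d i) (f i)) ->
  hom (\sum_(i <- r | P i) d i)%N (\prod_(i <- r | P i) f i).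
Proof.
by move=> h; apply: (big_rec2 hom) => [|i e g Pi]; [exact: hom1|apply: homM; exact: h].
Qed.

Lemma dd0 i : dd i 0 = 0.
Proof. by rewrite /dd rmorph0 subrr mul0r. Qed.

Lemma ddD i f g : dd i (f + g) = dd i f + dd i g.
Proof. by rewrite /dd rmorphD -mulrDl opprD addrACA. Qed.

Lemma dd_pull i c f : ac i c = c -> dd i (c * f) = c * dd i f.
Proof. by move=> hc; rewrite /dd rmorphM /= hc -mulrBr mulrA. Qed.

Lemma dd_inv i c : ac i c = c -> dd i c = 0.
Proof. by rewrite /dd => ->; rewrite subrr mul0r. Qed.

Lemma ddM i f g : dd i (f * g) = dd i f * g + ac i f * dd i g.
Proof. by rewrite /dd rmorphM /=; ring. Qed.

Lemma dd_var i k : letter i -> index k ->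
  dd i (x k) = if k == i then 1 else if k == i.+1 then - 1 else 0.
Proof.
move=> li lk; rewrite /dd; have h := x_succ li.
case: eqP => [->|/eqP ki]; first by rewrite ac_xl // divff.
case: eqP => [->|/eqP ki1]; last by rewrite ac_xn // subrr mul0r.
by rewrite ac_xr // -opprB mulNr divff.
Qed.

(** The predecessor truncates at degree 0, so the vanishing there is a separate conclusion. *)
Lemma hom_dd i d f : letter i -> hom d f ->
  hom d.-1 (dd i f) /\ (d = 0%N -> dd i f = 0).
Proof.
move=> li; elim=> {d f} [c hc|d k f lk hf [IH IH0]|d f g hf [IHf IHf0] hg [IHg IHg0]|d].
- by rewrite dd_inv //; split=> //; exact: hom_zero.
- split=> //=; rewrite ddM; apply: hom_add.
    rewrite dd_var //; case: eqP => _; first by rewrite mul1r.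
    case: eqP => _; first by rewrite mulN1r; apply: homN.
    by rewrite mul0r; exact: hom_zero.
  rewrite ac_x //; case: d hf IH IH0 => [|d] hf IH IH0; first by rewrite IH0 // mulr0; exact: hom_zero.
  by apply: hom_x => //; split_ifs; lia.
- by rewrite ddD; split=> [|h]; [apply: hom_add|rewrite IHf0 // IHg0 // addr0].
- by rewrite dd0; split=> //; exact: hom_zero.
Qed.

Lemma hom_foldr_dd d f a : letters n a -> hom d f ->
  hom (d - size a) (foldr dd f a) /\ ((d < size a)%N -> foldr dd f a = 0).
Proof.
move=> la hf; elim: a la => [|i a IH] /=; first by rewrite subn0.
case/andP=> li la; have [h1 h2] := IH la; have [h3 h4] := hom_dd li h1.
split; first by rewrite subnS.
move=> da; case: (ltnP d (size a)) => [/h2 ->|ad]; first by rewrite dd0.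
by apply: h4; lia.
Qed.

(** Dividing V by x_i - x_(i+1) leaves an s_i-invariant V', and V' f s_i(g) and V' s_i(f) g have the
    same symmetrization. *)
Lemma Sym_adj V i f g : letter i -> ac i V = - V ->
  Sym (V * (f * dd i g)) = Sym (V * (dd i f * g)).
Proof.
move=> li hV; pose V' := V / (x i - x i.+1).
have hV' : ac i V' = V'.
  by rewrite /V' !ac_rw /= hV ac_xl // ac_xr // -opprB invrN mulrNN.
have -> : V * (f * dd i g) = V' * f * g - V' * f * ac i g by rewrite /V' /dd; ring.
have -> : V * (dd i f * g) = V' * f * g - V' * ac i f * g by rewrite /V' /dd; ring.
clearbody V'; rewrite !SymB; congr (_ - _); rewrite -(Sym_act (s i)) !rmorphM /=.
by rewrite hV' ac_ac.
Qed.

Lemma Sym_adj_word V a f g : letters n a -> (forall i, i \in a -> ac i V = - V) ->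
  Sym (V * (f * foldr dd g a)) = Sym (V * (foldr dd f (rev a) * g)).
Proof.
elim: a f => [|i a IH] f //= /andP[li la] hV.
rewrite Sym_adj //; last by apply: hV; rewrite mem_head.
rewrite IH // => [|j ja]; last by apply: hV; rewrite inE ja orbT.
by rewrite rev_cons foldr_rcons.
Qed.

(* The divided differences are self-adjoint for the form Sym (V * f * g), so the
   word b can be moved from f0 to g, where it exceeds the degree. *)
Lemma Sym_vanish V b f0 g d : letters n b -> (forall i, i \in b -> ac i V = - V) ->
  foldr dd f0 b = 1 -> hom d g -> (d < size b)%N -> Sym (V * g) = 0.
Proof.
move=> lb hV b1 hg db.
have lrb : letters n (rev b) by rewrite /letters all_rev.
rewrite -[g]mul1r -b1 -[b]revK -Sym_adj_word => [||i]; rewrite ?mem_rev //; last exact: hV.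
have [_ ->] := hom_foldr_dd lrb hg; rewrite ?size_rev //.
by rewrite mulr0 mulr0 /Sym big1 // => u _; rewrite rmorph0.
Qed.

(** A word for the longest permutation of the m variables after the first o. Its divided differences
    send the staircase monomial [stair_mon o m] to 1. *)
Fixpoint stair o m : seq nat :=
  if m is m'.+1 then stair o m' ++ rev (iota o.+1 m') else [::].

Definition stair_mon o m : F := \prod_(0 <= k < m) x (o + k).+1 ^+ (m.-1 - k).

Lemma size_stair o m : size (stair o m) = (\sum_(k < m) k)%N.
Proof.
elim: m => [|m IH]; first by rewrite big_ord0.
by rewrite big_ord_recr /= size_cat IH size_rev size_iota.
Qed.

Lemma mem_stair o m i : i \in stair o m -> (o < i < o + m)%N.
Proof.
elim: m => //= m IH; rewrite mem_cat => /orP[/IH|]; first by lia.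
by rewrite mem_rev mem_iota; lia.
Qed.

(** Each divided difference meets y^(e+1) y'^e in its two variables, which is the invariant (y y')^e
    times y, and so lowers the exponent of y by one. Thus r steps turn the staircase of size m + 1
    into that of size m on the first r variables. *)
Lemma foldr_dd_stair_step o m r c : (o + m <= n)%N -> (r <= m)%N ->
  (forall i, (o < i <= o + m)%N -> ac i c = c) ->
  foldr dd (c * stair_mon o m.+1) (rev (iota o.+1 r)) =
  c * ((\prod_(0 <= k < r) x (o + k).+1 ^+ (m.-1 - k)) *
       \prod_(r <= k < m.+1) x (o + k).+1 ^+ (m - k)).
Proof.
move=> mn + hc; elim: r => [|r IH] rm.
  by rewrite /= big_geq // mul1r.
have -> : rev (iota o.+1 r.+1) = (o.+1 + r)%N :: rev (iota o.+1 r).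
  by rewrite -[r.+1]addn1 iotaD rev_cat.
rewrite /= IH ?(ltnW rm) //.
have li : letter (o.+1 + r) by lia.
rewrite dd_pull ?hc //; last by lia.
congr (_ * _); rewrite [\prod_(0 <= _ < r.+1) _]big_nat_recr //= -[RHS]mulrA.
rewrite [\prod_(r <= _ < _) _]big_ltn; last by lia.
rewrite [\prod_(r.+1 <= _ < _) _]big_ltn; last by lia.
set B := \prod_(_ <= _ < _) _; set A := \prod_(_ <= _ < _) _.
have hX k e : index (o + k).+1 -> k != r -> k != r.+1 ->
    ac (o.+1 + r)%N (x (o + k).+1 ^+ e) = x (o + k).+1 ^+ e.
  by move=> h1 h2 h3; rewrite rmorphXn /= ac_xn //; lia.
have hA : ac (o.+1 + r)%N A = A.
  rewrite /A rmorph_prod big_nat [RHS]big_nat; apply: eq_bigr => k hk.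
  by apply: hX; lia.
have hB : ac (o.+1 + r)%N B = B.
  rewrite /B rmorph_prod big_nat [RHS]big_nat; apply: eq_bigr => k hk.
  by apply: hX; lia.
have [e eE] : exists e, (m - r = e.+1)%N by exists (m - r).-1; lia.
have -> : (m - r.+1 = e)%N by lia.
have -> : (m.-1 - r = e)%N by lia.
rewrite eE dd_pull // !addSn.
set y := x (o + r).+1; rewrite -/y addnS; set y' := x (o + r).+2.
have hy : ac (o + r).+1 y = y' by apply: ac_xl; lia.
have hy' : ac (o + r).+1 y' = y by apply: ac_xr; lia.
have -> : y ^+ e.+1 * (y' ^+ e * B) = (y ^+ e * y' ^+ e * B) * y by rewrite exprS; ring.
rewrite dd_pull; last by rewrite !rmorphM !rmorphXn /= hy hy' hB; ring.
rewrite dd_var ?eqxx //; try lia.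
by rewrite mulr1 -!mulrA.
Qed.

Lemma foldr_dd_stair o m c : (o + m <= n.+1)%N ->
  (forall i, (o < i < o + m)%N -> ac i c = c) ->
  foldr dd (c * stair_mon o m) (stair o m) = c.
Proof.
elim: m => [|m IH] mn hc; first by rewrite /stair_mon big_geq // mulr1.
rewrite /= foldr_cat foldr_dd_stair_step //; try lia; last by move=> i hi; apply: hc; lia.
rewrite big_nat1 subnn expr0 mulr1; apply: IH; first by lia.
by move=> i hi; apply: hc; lia.
Qed.

(** * The functional phi and its vanishing on the q-Klyachko relations *)

Definition uu i : F := \sum_(0 <= k < i) x k.+1.
Definition zz i : F := q * x i - x i.+1.

Definition phi (f : F) : F := Tqall (f / \prod_(1 <= j < n.+1) zz j).

Lemma hom_uu i : (i <= n.+1)%N -> hom 1 (uu i).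
Proof.
by move=> hi; rewrite /uu big_nat; apply: hom_sum => k hk; apply: hom_var; lia.
Qed.

Lemma hom_zz i : letter i -> hom 1 (zz i).
Proof.
move=> li; apply: homB; last by apply: hom_var; lia.
by apply: hom_invM; [exact: invar_q|apply: hom_var; lia].
Qed.

Lemma uu0 : uu 0 = 0.
Proof. by rewrite /uu big_geq. Qed.

Lemma uuS i : uu i.+1 = uu i + x i.+1.
Proof. by rewrite /uu big_nat_recr. Qed.

Lemma zzE i : (0 < i)%N -> zz i = (1 + q) * uu i - q * uu i.-1 - uu i.+1.
Proof. by case: i => // i _; rewrite /zz /= !uuS; ring. Qed.

Lemma uuE i : (i <= n.+1)%N -> uu i = \sum_(a : 'I_n.+1 | (a < i)%N) xo a.
Proof. by move=> hi; rewrite /uu -(big_ord_widen _ (fun k => x k.+1) hi) big_mkord. Qed.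

Lemma sperm_stab i j (a : 'I_n.+1) : letter j -> j != i -> (s j a < i)%N = (a < i)%N.
Proof. by move=> lj ji; rewrite sperm_val //; split_ifs; lia. Qed.

Lemma ac_uu i j : letter j -> (i <= n.+1)%N -> j != i -> ac j (uu i) = uu i.
Proof.
move=> lj hi ji; rewrite uuE // rmorph_sum [RHS](reindex_inj (@perm_inj _ (s j))).
by apply: eq_big => [a|a _]; rewrite ?sperm_stab // act_xo.
Qed.

Definition qdiff (a b : 'I_n.+1) : F := q * xo a - xo b.
Definition xdiff (a b : 'I_n.+1) : F := xo a - xo b.
Definition qnum (P : pred ('I_n.+1 * 'I_n.+1)) : F := \prod_(p | P p) qdiff p.1 p.2.
Definition Vand : F := \prod_(p : 'I_n.+1 * 'I_n.+1 | (p.1 < p.2)%N) xdiff p.1 p.2.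

Lemma act_qdiff u a b : sact S u (qdiff a b) = qdiff (u a) (u b).
Proof. by rewrite /qdiff !ac_rw /= !act_xo. Qed.

Lemma act_xdiff u a b : sact S u (xdiff a b) = xdiff (u a) (u b).
Proof. by rewrite /xdiff !ac_rw /= !act_xo. Qed.

Lemma ac_Vand j : letter j -> ac j Vand = - Vand.
Proof.
move=> lj; pose p0 : 'I_n.+1 * 'I_n.+1 := (inord j.-1, inord j).
have -> : Vand = xdiff p0.1 p0.2 *
    \prod_(p : 'I_n.+1 * 'I_n.+1 | (p.1 < p.2)%N && (p != p0)) xdiff p.1 p.2.
  by rewrite /Vand (bigD1 p0) //= !inordK; lia.
rewrite rmorphM /= (act_pairprod _ _ act_xdiff) act_xdiff /= sperm_l // sperm_r //.
rewrite -mulNr; congr (_ * _); first by rewrite /xdiff opprB.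
by apply: eq_bigl => -[a b]; exact: pair_swap.
Qed.

Lemma Vand_neq0 : Vand != 0.
Proof.
rewrite prodf_seq_neq0; apply/allP => -[a b] _ /=; apply/implyP => ab.
apply: x_neq => /=; try exact: ltn_ord.
by rewrite eqSS; apply: contraTneq ab => ->; rewrite ltnn.
Qed.

(** The denominator of phi removes the adjacent pairs and leaves [far]. A factor z_i restores the
    adjacent pair (i-1, i), which crosses the cut at i; the product then splits into all crossing
    pairs and the [inner] ones. *)
Definition far (p : 'I_n.+1 * 'I_n.+1) := (p.1.+1 < p.2)%N.
Definition crossing i (p : 'I_n.+1 * 'I_n.+1) := (p.1 < i <= p.2)%N.
Definition inner i (p : 'I_n.+1 * 'I_n.+1) :=
  (p.1.+1 < p.2)%N && ((p.1 < i)%N == (p.2 < i)%N).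

Lemma ac_crossing i j : letter j -> j != i -> ac j (qnum (crossing i)) = qnum (crossing i).
Proof.
move=> lj ji; rewrite /qnum (act_pairprod _ _ act_qdiff); apply: eq_bigl => -[a b].
by rewrite /crossing /= !(leqNgt i) !sperm_stab.
Qed.

Lemma sum_interval m lo hi : (\sum_(a < m) ((lo <= a) && (a < hi)) = minn m hi - lo)%N.
Proof. by elim: m => [|m IH]; rewrite ?big_ord0 ?big_ord_recr /= ?IH; lia. Qed.

(** The degree counts the non-adjacent pairs on one side of the cut by their larger entry. *)
Lemma hom_inner i : (i <= n.+1)%N ->
  hom (\sum_(k < i) k.-1 + \sum_(k < n.+1 - i) k.-1)%N (qnum (inner i)).
Proof.
move=> hi; have -> : (\sum_(k < i) k.-1 + \sum_(k < n.+1 - i) k.-1 =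
    \sum_(p : 'I_n.+1 * 'I_n.+1 | inner i p) 1)%N.
  transitivity (\sum_(b < n.+1) if (b < i)%N then b.-1 else (b - i).-1)%N.
    have split m : (\sum_(k < i) k.-1 + \sum_(k < m) k.-1 =
        \sum_(b < i + m) if (b < i)%N then b.-1 else (b - i).-1)%N.
      elim: m => [|m IH].
        by rewrite big_ord0 !addn0; apply: eq_bigr => k _; rewrite ltn_ord.
      rewrite addnS !big_ord_recr /= addnA IH; congr (_ + _)%N.
      by rewrite ltnNge leq_addr /= addKn.
    by have := split (n.+1 - i)%N; rewrite subnKC.
  pose h (a b : 'I_n.+1) := (if inner i (a, b) then 1 else 0)%N.
  transitivity (\sum_p h p.1 p.2)%N; last first.
    by rewrite [RHS]big_mkcond; apply: eq_bigr => -[a b].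
  rewrite -(pair_bigA _ h) exchange_big; apply: eq_bigr => b _ /=.
  transitivity (\sum_(a < n.+1) (((if b < i then 0 else i) <= a) && (a < b.-1)))%N.
    by rewrite sum_interval; have := ltn_ord b; case: ifP; lia.
  apply: eq_bigr => a _; rewrite (_ : h a b = inner i (a, b)); last by rewrite /h; case: inner.
  by rewrite /inner /=; congr nat_of_bool; case: (ltnP b i) => ?; case: (ltnP a i) => ?; lia.
apply: hom_prod => p _; apply: homB; last by apply: hom_var; exact: ltn_ord.
by apply: hom_invM; [exact: invar_q|apply: hom_var; exact: ltn_ord].
Qed.

Lemma zz_Num i : letter i -> zz i = qdiff (inord i.-1) (inord i).
Proof.
by move=> /andP[i0 hi]; rewrite /zz /qdiff /xo !inordK ?prednK // ltnW.
Qed.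

(** The product of the z_j consists of the factors of the adjacent pairs in the numerator of [Pi]
    and cancels them. *)
Lemma phiE f : phi f = poinc / Sc 1 *
  Sym (qnum far / Vand * f).
Proof.
rewrite /phi TqallE /Sc; congr (_ * Sym _).
have -> : Pi = qnum (fun p => p.1 < p.2)%N / Vand.
  by rewrite /Pi /qnum /Vand -prodf_div.
have -> : qnum (fun p => p.1 < p.2)%N =
    qnum far * \prod_(1 <= j < n.+1) zz j.
  rewrite /qnum (bigID far) /=; congr (_ * _).
    by apply: eq_bigl => p; rewrite /far; lia.
  transitivity (\prod_(a : 'I_n.+1) \prod_(b : 'I_n.+1 | (b == a.+1 :> nat)) qdiff a b).
    by rewrite pair_big_dep /=; apply: eq_bigl => p; rewrite /far; lia.
  rewrite big_ord_recr /= [X in _ * X]big1 ?mulr1; last first.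
    by move=> b /eqP h; have := ltn_ord b; rewrite h ltnn.
  rewrite big_add1 /= big_mkord; apply: eq_bigr => k _.
  have kn := ltn_ord k; rewrite zz_Num ?ltnS //.
  rewrite (big_pred1 (inord k.+1)) => [|b]; last first.
    by rewrite /= -val_eqE /= inordK.
  by congr qdiff; apply: val_inj; rewrite /= inordK //; lia.
have : \prod_(1 <= j < n.+1) zz j != 0.
  rewrite prodf_seq_neq0; apply/allP => j; rewrite mem_index_iota => hj.
  by apply: qx_neq; lia.
move: (\prod_(_ <= _ < _) _) (qnum _) Vand Vand_neq0 => a b c hc ha.
by field; rewrite ha hc.
Qed.

(** [uu i] and the crossing product are symmetric under S_i x S_(n+1-i), so over [Vand] they form an
    antisymmetric kernel. The longest element of this subgroup has one letter per pair inside a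
    block, while [inner] omits the adjacent pairs; their number i - 1 + (n - i), or n for i = n + 1,
    is the bound on d. *)
Lemma Sym_block_vanish i g d : (0 < i <= n.+1)%N -> hom d g ->
  (d < i.-1 + (n.+1 - i).-1)%N ->
  Sym (uu i * qnum (crossing i) / Vand * (qnum (inner i) * g)) = 0.
Proof.
move=> /andP[i0 hi] hg hd.
apply: (@Sym_vanish _ (stair 0 i ++ stair i (n.+1 - i))
          (stair_mon 0 i * stair_mon i (n.+1 - i)) _
          (\sum_(k < i) k.-1 + \sum_(k < n.+1 - i) k.-1 + d)).
- rewrite /letters all_cat; apply/andP; split; apply/allP => j /mem_stair; lia.
- move=> j; rewrite mem_cat => hj.
  have [lj ji] : letter j /\ j != i by case/orP: hj => /mem_stair; lia.
  rewrite !ac_rw /= ac_uu // ac_crossing // ac_Vand //.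
  by rewrite invrN mulrN.
- have -> : foldr dd (stair_mon 0 i * stair_mon i (n.+1 - i)) (stair 0 i ++ stair i (n.+1 - i))
    = foldr dd (1 * stair_mon 0 i) (stair 0 i).
    rewrite foldr_cat mul1r foldr_dd_stair //; first by lia.
    move=> j hj; rewrite /stair_mon rmorph_prod big_nat [RHS]big_nat; apply: eq_bigr => k hk.
    by rewrite rmorphXn /= ac_xn //; lia.
  by apply: foldr_dd_stair => // j _; rewrite rmorph1.
- exact/homM/hg/hom_inner.
rewrite size_cat !size_stair.
have tri m : (\sum_(k < m) k = \sum_(k < m) k.-1 + m.-1)%N.
  elim: m => [|m IH]; first by rewrite !big_ord0.
  by rewrite !big_ord_recr /= IH.
rewrite (tri i) (tri (n.+1 - i)%N).
by move: (\sum_(k < i) _)%N (\sum_(k < n.+1 - i) _)%N => a b; lia.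
Qed.

Lemma phi_uz i g d : letter i -> hom d g -> d.+2 = n -> phi (uu i * zz i * g) = 0.
Proof.
move=> li hg hd; rewrite phiE.
have e : qnum far * zz i = qnum (crossing i) * qnum (inner i).
  pose p0 : 'I_n.+1 * 'I_n.+1 := (inord i.-1, inord i).
  have p0E (a b : 'I_n.+1) : ((a, b) == p0) = (a == i.-1 :> nat) && (b == i :> nat).
    by rewrite xpair_eqE -!val_eqE /= !inordK //; lia.
  transitivity (qnum (fun p => far p || (p == p0))).
    rewrite /qnum [RHS](bigD1 p0) /= ?eqxx ?orbT // mulrC zz_Num //; congr (_ * _).
    by apply: eq_bigl => -[a b]; rewrite p0E /far /=; lia.
  rewrite /qnum (bigID (crossing i)) /=; congr (_ * _); apply: eq_bigl => -[a b];
    by rewrite p0E /far /crossing /inner /=; lia.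
have -> : qnum far / Vand * (uu i * zz i * g) =
  uu i * qnum (crossing i) / Vand * (qnum (inner i) * g).
  transitivity ((qnum far * zz i) * (uu i * g / Vand)).
    by move: (qnum _) (Vand^-1) (zz i) => a b c; ring.
  by rewrite e; move: (qnum (crossing i)) (Vand^-1) (qnum (inner i)) => a b c; ring.
by rewrite (Sym_block_vanish (d := d)) ?mulr0 //; lia.
Qed.

(** No pair crosses the cut at n + 1, so no factor z_i has to be supplied, and the bound is d <
    n. *)
Lemma phi_un g d : hom d g -> d.+1 = n -> phi (uu n.+1 * g) = 0.
Proof.
move=> hg hd; rewrite phiE.
have e : qnum far = qnum (crossing n.+1) * qnum (inner n.+1).
  rewrite [qnum (crossing _)]big_pred0 ?mul1r.
    by apply: eq_bigl => p; rewrite /inner /far !ltn_ord andbT.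
  by move=> p; rewrite /crossing (leqNgt n.+1) !ltn_ord.
have -> : qnum far / Vand * (uu n.+1 * g) =
  uu n.+1 * qnum (crossing n.+1) / Vand * (qnum (inner n.+1) * g).
  by rewrite e; move: (qnum (crossing _)) (Vand^-1) (qnum (inner _)) => a b c; ring.
by rewrite (Sym_block_vanish (d := d)) ?mulr0 //; lia.
Qed.

Lemma phi_lin c f g : invar c -> phi (c * f + g) = c * phi f + phi g.
Proof.
move=> hc; rewrite !phiE; move: (poinc / _) (qnum far / _) => k W.
by rewrite [W * (_ + _)]mulrDr [W * (c * _)]mulrCA SymD (SymZ _ hc) mulrDr [k * (c * _)]mulrCA.
Qed.

(** The quotient inside phi is 1, and every T_i multiplies a power of q by q. *)
Lemma phi_prodz : phi (\prod_(1 <= j < n.+1) zz j) = poinc.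
Proof.
rewrite /phi divff; last first.
  rewrite prodf_seq_neq0; apply/allP => j; rewrite mem_index_iota => hj.
  by apply: qx_neq; lia.
apply: eq_bigr => w _; have /and3P[] := head_Red w; rewrite /Tqw => + _ /eqP <-.
elim: (head _ _) => [|i a IH] //= /andP[li la]; rewrite IH //.
rewrite TqE // rmorphXn /= sact_q exprS -[RHS](mulfK (x_succ li)); congr (_ / _).
by ring.
Qed.

(** ** The q-analogue of Klyachko's relations *)

Lemma phiD f g : phi (f + g) = phi f + phi g.
Proof. by have := phi_lin f g invar1; rewrite !mul1r. Qed.

Lemma phi0 : phi 0 = 0.
Proof. by apply: (addrI (phi 0)); rewrite -phiD !addr0. Qed.

Lemma phiZ c f : invar c -> phi (c * f) = c * phi f.
Proof. by move=> hc; have := phi_lin f 0 hc; rewrite !addr0 phi0 addr0. Qed.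

Lemma phiN f : phi (- f) = - phi f.
Proof. by apply: (addrI (phi f)); rewrite -phiD !subrr phi0. Qed.

Lemma phiB f g : phi (f - g) = phi f - phi g.
Proof. by rewrite phiD phiN. Qed.

Lemma phi_sum (I : Type) (r : seq I) (P : pred I) (f : I -> F) :
  phi (\sum_(i <- r | P i) f i) = \sum_(i <- r | P i) phi (f i).
Proof. exact: (big_morph phi phiD phi0). Qed.

(* The radical, in degree d, of the pairing phi (f * h) with deg f + deg h = n. *)
Definition nul d f := forall e h, (d + e)%N = n -> hom e h -> phi (f * h) = 0.

Lemma nul0 d : nul d 0.
Proof. by move=> e h _ _; rewrite mul0r phi0. Qed.

Lemma nulD d f g : nul d f -> nul d g -> nul d (f + g).
Proof. by move=> hf hg e h de he; rewrite mulrDl phiD (hf e) // (hg e) // addr0. Qed.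

Lemma nulN d f : nul d f -> nul d (- f).
Proof. by move=> hf e h de he; rewrite mulNr phiN (hf e) ?oppr0. Qed.

Lemma nulB d f g : nul d f -> nul d g -> nul d (f - g).
Proof. by move=> hf /nulN; apply: nulD. Qed.

Lemma nulM d e f g : nul d f -> hom e g -> nul (d + e) (f * g).
Proof.
move=> hf hg c h dc hh; rewrite -mulrA; apply: (hf (e + c)%N); first by lia.
exact: homM.
Qed.

Lemma nulMl d e f g : hom e g -> nul d f -> nul (e + d) (g * f).
Proof. by move=> hg hf; rewrite mulrC addnC; apply: nulM. Qed.

Lemma nulZ d c f : invar c -> nul d f -> nul d (c * f).
Proof. by move=> hc hf; apply: (@nulMl d 0) => //; exact: hom_inv. Qed.

Lemma nul_uz i : letter i -> nul 2 (uu i * zz i).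
Proof. by move=> li e h en he; apply: phi_uz en. Qed.

Lemma nul_un : nul 1 (uu n.+1).
Proof. by move=> e h en he; apply: phi_un en. Qed.

Lemma invar_1q : invar (1 - q).
Proof. by apply: invarB; [exact: invar1|exact: invar_q]. Qed.

Lemma invar_qX d : invar (q ^+ d).
Proof. exact/invarX/invar_q. Qed.

Definition EE := descsum q dd uu (fun d f => q ^+ d * f).

Lemma EE0 sq f : EE 0 sq f = f.
Proof. by elim: sq => [|i sq IH] /=; rewrite /EE /= ?expr0 ?mul1r // addr0. Qed.

Lemma EE_nil d f : EE d [::] f = q ^+ d * f.
Proof. by []. Qed.

Lemma EE_cons d i sq f :
  EE d (i :: sq) f = EE d sq f + (if d is d'.+1 then (1 - q) * uu i * EE d' sq (dd i f) else 0).
Proof. by []. Qed.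

Lemma EED d sq f g : EE d sq (f + g) = EE d sq f + EE d sq g.
Proof.
elim: sq d f g => [|i sq IH] d f g; rewrite ?EE_nil ?EE_cons; first by rewrite mulrDr.
rewrite IH; case: d => [|d]; first by rewrite !addr0.
by rewrite ddD IH mulrDr addrACA.
Qed.

Lemma EEz d sq : EE d sq 0 = 0.
Proof. by apply: (addrI (EE d sq 0)); rewrite -EED !addr0. Qed.

Lemma EEN d sq f : EE d sq (- f) = - EE d sq f.
Proof. by apply: (addrI (EE d sq f)); rewrite -EED !subrr EEz. Qed.

Lemma hom_EE d sq f : letters n sq -> hom d f -> hom d (EE d sq f).
Proof.
elim: sq d f => [|i sq IH] d f.
  by move=> _ hf; rewrite EE_nil; apply: hom_invM => //; exact: invar_qX.
case/andP=> li ls hf; rewrite !EE_cons; apply: hom_add; first exact: IH.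
case: d hf => [|d] hf; first exact: hom_zero.
rewrite -mulrA; apply: hom_invM; first exact: invar_1q.
apply: (@homM 1); first by apply: hom_uu; lia.
by apply: IH => //; case: (hom_dd li hf).
Qed.

(** All divided differences pass over c; the factor q appears because c raises the degree by one. *)
Lemma EE_pull d sq c f : letters n sq -> (forall i, i \in sq -> ac i c = c) ->
  hom d f -> EE d.+1 sq (c * f) = q * c * EE d sq f.
Proof.
elim: sq d f => [|i sq IH] d f.
  by move=> _ _ _; rewrite !EE_nil exprS; ring.
case/andP=> li ls hc hf; rewrite !EE_cons.
have hc' j : j \in sq -> ac j c = c by move=> js; apply: hc; rewrite inE js orbT.
rewrite IH // dd_pull; last by apply: hc; rewrite mem_head.
have [h1 h2] := hom_dd li hf.
case: d hf h1 h2 => [|d] hf h1 h2; first by rewrite h2 // mulr0 EEz mulr0 !addr0.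
rewrite IH //; ring.
Qed.

Lemma dd_uu k : letter k -> dd k (uu k) = 1.
Proof.
case: k => // k lk; rewrite uuS ddD dd_inv; last by apply: ac_uu; lia.
by rewrite add0r dd_var ?eqxx //; lia.
Qed.

Lemma ac_uuk k : letter k -> ac k (uu k) = uu k.+1 - x k.
Proof.
case: k => // k lk; rewrite !uuS rmorphD /= ac_xl // ac_uu //; try lia.
by ring.
Qed.

(* The only non-formal step: for j = k the two sides differ by a multiple of
   u_k (q x_k - x_(k+1)), which lies in the radical. *)
Lemma EE_uu m k j d g : (0 < k)%N -> (k + m = n.+1)%N -> (k <= j <= n.+1)%N ->
  hom d g -> nul d.+1 (EE d.+1 (iota k m) (uu j * g) - uu j * EE d (iota k m) g).
Proof.
elim: m k j d g => [|m IH] k j d g k0 km kj hg.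
  have -> : j = n.+1 by lia.
  rewrite !EE_nil (_ : _ - _ = uu n.+1 * ((q - 1) * q ^+ d * g)); last by rewrite exprS; ring.
  rewrite -addn1 addnC; apply: nulM; first exact: nul_un.
  apply: hom_invM => //; apply: invarM; last exact: invar_qX.
  by apply: invarB; [exact: invar_q|exact: invar1].
have lk : letter k by lia.
have ls : letters n (iota k.+1 m) by apply/allP => i; rewrite mem_iota; lia.
have [h1 h2] := hom_dd lk hg.
rewrite !EE_cons.
move: kj; case/andP; rewrite leq_eqVlt => /orP[/eqP <- {j} _|kj jn].
  rewrite (_ : dd k (uu k * g) = g + (uu k.+1 - x k) * dd k g); last first.
    by rewrite ddM dd_uu // ac_uuk // mul1r.
  rewrite EED EE_pull //; last by move=> i; rewrite mem_iota => hi; apply: ac_uu; lia.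
  case: d hg h1 h2 => [|d] hg h1 h2.
    rewrite h2 // mulr0 EEz (_ : _ - _ = 0); [exact: nul0|ring].
  set h := dd k g; rewrite [(uu k.+1 - x k) * h]mulrBl EED EEN.
  rewrite (_ : EE d.+1 _ (x k * h) = q * x k * EE d (iota k.+1 m) h); last first.
    by apply: EE_pull => // i; rewrite mem_iota => hi; apply: ac_xn; lia.
  have := IH k.+1 k.+1 d h isT _ _ h1; rewrite addSnnS km leqnn => /(_ erefl).
  have -> : (k < n.+1)%N by lia.
  move/(_ isT); set A := EE d.+1 _ _; set B := EE d _ _; set C := EE _ _ _ => nu.
  rewrite (_ : _ - _ = (1 - q) * (uu k * (A - uu k.+1 * B)) - (1 - q) * (uu k * zz k * B)).
    apply: nulB; apply: nulZ; try exact: invar_1q.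
      by apply: (@nulMl _ 1) nu; apply: hom_uu; lia.
    apply: (@nulM 2); first exact: nul_uz.
    exact: hom_EE.
  by rewrite /zz; have := uuS k; move: (uu k.+1) => v ->; ring.
rewrite (_ : EE d.+1 _ _ + _ - _ =
  (EE d.+1 (iota k.+1 m) (uu j * g) - uu j * EE d (iota k.+1 m) g) +
  (1 - q) * (uu k * (EE d (iota k.+1 m) (dd k (uu j * g)) -
     (if d is d'.+1 then uu j * EE d' (iota k.+1 m) (dd k g) else 0)))); last first.
  by case: (d) => [|?]; ring.
apply: nulD; first by apply: IH => //; lia.
apply: nulZ; first exact: invar_1q.
apply: (@nulMl d 1); first by apply: hom_uu; lia.
rewrite dd_pull; last by apply: ac_uu; lia.
case: d hg h1 h2 => [|d] hg h1 h2; first by rewrite h2 // mulr0 EEz subrr; exact: nul0.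
by apply: IH => //; lia.
Qed.

(** Since x_(i+1) = u_(i+1) - u_i, it is enough that the expansion commutes with multiplication by
    each u_j modulo the radical, which is [EE_uu]. *)
Lemma EE_id d f : hom d f -> nul d (EE d (iota 1 n) f - f).
Proof.
elim=> {d f} [c hc|d i f li hf IH|d f g hf IHf hg IHg|d].
- by rewrite EE0 subrr; exact: nul0.
- case: i li => // i li.
  have -> : x i.+1 * f = uu i.+1 * f - uu i * f by rewrite uuS; ring.
  rewrite EED EEN.
  rewrite (_ : _ - _ = (EE d.+1 (iota 1 n) (uu i.+1 * f) - uu i.+1 * EE d (iota 1 n) f)
    - (EE d.+1 (iota 1 n) (uu i * f) - uu i * EE d (iota 1 n) f)
    + x i.+1 * (EE d (iota 1 n) f - f)); last by rewrite uuS; ring.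
  apply: nulD; last by apply: (@nulMl _ 1) IH; apply: hom_var.
  apply: nulB; first by apply: EE_uu.
  (* [EE_uu] needs a positive index; for i = 0 both terms vanish with u_0. *)
  case: i li => [|i] li; last by apply: EE_uu => //; lia.
  by rewrite uu0 !mul0r EEz subrr; exact: nul0.
- by rewrite EED opprD addrACA; apply: nulD.
by rewrite EEz subrr; exact: nul0.
Qed.

Definition wexp := nwordsum q dd (fun f => f) uu (iota 1 n) ltn.

Lemma pairwise_ltn_iota i m : pairwise (fun a b => (a < b)%N && ~~ (b < a)%N) (iota i m).
Proof.
have -> : pairwise (fun a b => (a < b)%N && ~~ (b < a)%N) (iota i m) = pairwise ltn (iota i m).
  by apply: eq_pairwise => a b /=; lia.
by rewrite -(sorted_pairwise ltn_trans) iota_ltn_sorted.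
Qed.

Lemma phi_radical l f : hom l f -> nul l (f - wexp l f).
Proof.
elim/ltn_ind: l f => l IH f hf.
have key sq : letters n sq -> forall d g, (d <= l)%N -> hom d g ->
    nul d (EE d sq g - descsum q dd uu (fun d u => q ^+ d * wexp d u) d sq g
           - q ^+ d * (g - wexp d g)).
  elim: sq => [|i sq IHs].
    by move=> _ d g dl hg; rewrite EE_nil /= (_ : _ - _ = 0); [exact: nul0|ring].
  case/andP=> li ls d g dl hg; rewrite EE_cons [descsum _ _ _ _ d (i :: sq) g]/=.
  case: d dl hg => [|d] dl hg.
    by rewrite !addr0; apply: IHs.
  have [h1 _] := hom_dd li hg; rewrite /= in h1.
  set D := descsum _ _ _ _ _ _; have n1 := IHs ls d.+1 g dl hg.
  have n2 := nulD (IHs ls d _ (ltnW dl) h1) (nulZ (invar_qX d) (IH d dl _ h1)).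
  rewrite subrK in n2.
  have n3 := nulD n1 (nulZ invar_1q (@nulMl _ 1 _ _ (hom_uu (ltnW (proj2 (andP li)))) n2)).
  by move: n3; congr nul; rewrite -/D; ring.
have lit : letters n (iota 1 n) by apply/allP => i; rewrite mem_iota; lia.
have := key _ lit l f (leqnn l) hf.
have -> : descsum q dd uu (fun d u => q ^+ d * wexp d u) l (iota 1 n) f = wexp l f.
  apply: (@descsum_nwordsum _ q _ dd (fun f => f) 0 uu) => [|i _||i t|] //.
  - exact: q_gen.
  - exact: dd0.
  - by rewrite mem_iota => li; apply: dd2; lia.
  - exact: pairwise_ltn_iota.
move=> n1; case: l IH hf key n1 => [|l] IH hf key n1.
  by rewrite /wexp /nwordsum qfact_inv0 mul1r wordsum0 subrr; exact: nul0.
have n2 := nulB n1 (EE_id hf).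
have -> : f - wexp l.+1 f = (1 - q ^+ l.+1)^-1 * ((1 - q ^+ l.+1) * (f - wexp l.+1 f)).
  by rewrite mulKf // q_gen.
apply: nulZ.
  by move=> u; rewrite fmorphV rmorphB rmorph1 rmorphXn /= sact_q.
by move: n2; congr nul; ring.
Qed.

(** ** Schubert polynomials *)

Lemma Red_uniq (w : 'S_n.+1) : uniq (Red w).
Proof. by apply: filter_uniq; rewrite wordsE; apply/wordsL_uniq/iota_uniq. Qed.

Lemma big_Red (w : 'S_n.+1) (h : seq nat -> F) :
  \sum_(a <- words n.+1 (len w) | reduced w a) h a = \sum_(a <- Red w) h a.
Proof.
rewrite -big_filter; apply: perm_big; apply: uniq_perm; last 1 first.
- move=> a; rewrite mem_Red mem_filter andb_idr // => /and3P[la _ /eqP <-].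
  by rewrite mem_words eqxx (eq_all (@letter_iota n)).
- by apply: filter_uniq; rewrite wordsE; apply/wordsL_uniq/iota_uniq.
- exact: Red_uniq.
Qed.

Lemma phi_Red (w : 'S_n.+1) f : hom n f -> len w = n ->
  (forall a, letters n a -> size a = n -> foldr dd f a = (reduced w a)%:R) ->
  phi f = qfact_inv q n * \sum_(a <- Red w) q ^+ comaj a * phi (\prod_(i <- a) uu i).
Proof.
(* In degree n the complementary degree is 0, and pairing with 1 gives phi itself. *)
move=> hf lw hw; have := phi_radical hf (addn0 n) hom1.
rewrite mulr1 phiB => /eqP; rewrite subr_eq0 => /eqP ->.
rewrite /wexp /nwordsum phiZ; last first.
  move=> u; rewrite /qfact_inv rmorphM fmorphV rmorphXn rmorph_prod /= invar_1q; congr (_ / _).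
  by apply: eq_bigr => i _; rewrite rmorphB rmorph1 rmorphXn /= sact_q.
congr (_ * _); rewrite /wordsum phi_sum -big_Red lw wordsE [RHS]big_mkcond.
rewrite big_seq [RHS]big_seq; apply: eq_bigr => a.
rewrite mem_wordsL => /andP[/eqP sa la].
have la' : letters n a by apply: sub_all la => i; rewrite inE mem_iota; lia.
rewrite hw //; case: (reduced w a); last by rewrite mulr0 phi0.
by rewrite mulr1 phiZ //; exact: invar_qX.
Qed.

Definition schubert (w : 'S_n.+1) : F :=
  foldl (fun g i => dd i g) (\prod_(1 <= i < n.+1) x i ^+ (n.+1 - i))
    (head [::] (Red (w * w0 n.+1)%g)).

Lemma staircaseE : \prod_(1 <= i < n.+1) x i ^+ (n.+1 - i) = stair_mon 0 n.+1.
Proof.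
rewrite /stair_mon [RHS]big_nat_recr //= subnn expr0 mulr1 big_add1 /=.
by apply: eq_big_nat => i hi; rewrite add0n subSS.
Qed.

Lemma w0V : ((w0 n.+1)^-1 = w0 n.+1)%g.
Proof.
by apply/eqP; rewrite eq_invg_mul; apply/eqP/permP => k; rewrite permM !permE rev_ordK.
Qed.

Lemma dd_nonred a g : letters n a -> ~~ reduced (word_perm n.+1 a) a -> foldr dd g a = 0.
Proof.
apply: (foldr_nonred (z := 0)) => [i j h|i h|i h|i _].
- exact: dd_comm.
- exact: dd_braid.
- exact: dd2.
- exact: dd0.
Qed.

(** The staircase word is reduced because a nonreduced word of divided differences acts as zero,
    whereas this one produces 1. Its length then forces the permutation to be [w0]. *)
Lemma dd_w0 a : reduced (w0 n.+1) a -> foldr dd (stair_mon 0 n.+1) a = 1.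
Proof.
move=> ra; have st : foldr dd (stair_mon 0 n.+1) (stair 0 n.+1) = 1.
  by rewrite -[stair_mon _ _]mul1r foldr_dd_stair // => i _; rewrite rmorph1.
have ls : letters n (stair 0 n.+1) by apply/allP => i /mem_stair; lia.
have rs : reduced (word_perm n.+1 (stair 0 n.+1)) (stair 0 n.+1).
  apply: contraT => /(dd_nonred (stair_mon 0 n.+1) ls); rewrite st => /eqP.
  by rewrite oner_eq0.
have e : word_perm n.+1 (stair 0 n.+1) = w0 n.+1.
  by apply: len_max_w0; rewrite -(red_size rs) size_stair -bin2_sum big_mkord.
rewrite -st; apply: (matsumoto dd_comm dd_braid) ra _.
by rewrite -e.
Qed.

Lemma len_w0 : len (w0 n.+1) = 'C(n.+1, 2).
Proof. by have := len_max (1%g : 'S_n.+1); rewrite mul1g len1 addn0. Qed.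

(** Prefixing a to the reversed word that defines [schubert w] gives C(n+1, 2) letters applied to
    the staircase. Such a word is either a reduced word of [w0], which happens when a is one of w
    and gives 1, or nonreduced, which gives 0. *)
Lemma dd_schubert w a : letters n a -> size a = len w ->
  foldr dd (schubert w) a = (reduced w a)%:R.
Proof.
move=> la sa; rewrite /schubert -[head _ _]revK foldl_rev staircaseE; set b := head _ _.
have rb : reduced (w * w0 n.+1)%g b := head_Red _.
have lb : letters n (rev b) by rewrite /letters all_rev; exact: red_letters rb.
have wab : word_perm n.+1 (a ++ rev b) = ((w0 n.+1) * (w^-1 * word_perm n.+1 a))%g.
  by rewrite wp_cat wp_rev (red_wp rb) invMg w0V mulgA.
have lab : letters n (a ++ rev b) by rewrite /letters all_cat; apply/andP.
have sab : size (a ++ rev b) = 'C(n.+1, 2).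
  by rewrite size_cat size_rev (red_size rb) sa addnC len_max.
rewrite -foldr_cat; case: (boolP (reduced w a)) => ra.
  apply: dd_w0; apply/and3P; split=> //; last by rewrite sab len_w0.
  by rewrite wab (red_wp ra) mulVg mulg1.
apply: dd_nonred => //; apply: contra ra => rab.
have := len_max_w0 (etrans (esym (red_size rab)) sab).
rewrite wab -[RHS]mulg1 => /mulgI e.
apply/and3P; split=> //; last exact/eqP.
by rewrite -[word_perm _ _]mul1g -(mulgV w) -mulgA e mulg1.
Qed.

Lemma hom_schubert w : hom (len w) (schubert w).
Proof.
rewrite /schubert -[head _ _]revK foldl_rev staircaseE; set b := head _ _.
have rb : reduced (w * w0 n.+1)%g b := head_Red _.
have lb : letters n (rev b) by rewrite /letters all_rev; exact: red_letters rb.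
have hs : hom 'C(n.+1, 2) (stair_mon 0 n.+1).
  have -> : 'C(n.+1, 2) = (\sum_(k < n.+1) (n - k))%N.
    rewrite -bin2_sum big_mkord (reindex_inj rev_ord_inj) /=.
    by apply: eq_bigr => k _; rewrite subSS.
  rewrite /stair_mon big_mkord; apply: hom_prod => k _ /=.
  elim: (n - k)%N => [|e IH]; first exact: hom1.
  by rewrite exprS; apply: hom_x => //; have := ltn_ord k; lia.
have [+ _] := hom_foldr_dd lb hs.
by rewrite size_rev (red_size rb) -(len_max w) addKn.
Qed.

Lemma phi_schubert w : len w = n ->
  phi (schubert w) = qfact_inv q n * \sum_(a <- Red w) q ^+ comaj a * phi (\prod_(i <- a) uu i).
Proof.
move=> lw; apply: phi_Red => //; first by have := hom_schubert w; rewrite lw.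
by move=> a la sa; apply: dd_schubert; rewrite // sa lw.
Qed.

(** * The value of phi at u_1 .. u_n *)

Lemma hom_prod_uu (a : seq nat) : all (fun i => (i <= n.+1)%N) a ->
  hom (size a) (\prod_(i <- a) uu i).
Proof.
elim: a => [|i a IH] /=; first by rewrite big_nil => _; exact: hom1.
by case/andP=> hi ha; rewrite big_cons -add1n; apply: homM; [exact: hom_uu|exact: IH].
Qed.

Lemma hom_prod_zz a b : (0 < a)%N -> (b <= n.+1)%N -> hom (b - a) (\prod_(a <= i < b) zz i).
Proof.
move=> a0 bn; case: (leqP b a) => ab.
  by rewrite big_geq // (eqP ab); exact: hom1.
elim: b ab bn => // b IH ab bn; rewrite big_nat_recr //=.
have := ab; rewrite ltnS leq_eqVlt => /orP[/eqP e|ab'].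
  by rewrite -e big_geq // mul1r subSnn; apply: hom_zz; lia.
by rewrite subSn // -addn1; apply: homM; [apply: IH; lia|apply: hom_zz; lia].
Qed.

Lemma hom_prod_uu_nat a b : (b <= n.+1)%N -> hom (b - a) (\prod_(a <= i < b) uu i).
Proof.
move=> bn; have := @hom_prod_uu (index_iota a b); rewrite size_iota; apply.
by apply/allP => i; rewrite mem_index_iota; lia.
Qed.

Lemma invar_1Dq : invar (1 + q).
Proof. by move=> u; rewrite rmorphD rmorph1 /= sact_q. Qed.

(* Expanding z_k = (1 + q) u_k - q u_(k-1) - u_(k+1), the middle term vanishes and
   the last one is a gambler's ruin on the points k, .., n + 1. *)
Lemma phi_telescope k : letter k ->
  (1 - q ^+ (n.+1 - k)) * phi (\prod_(1 <= j < k.+1) zz j * \prod_(k.+1 <= j < n.+1) uu j) =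
  (1 - q ^+ (n.+2 - k)) * phi (\prod_(1 <= j < k) zz j * \prod_(k <= j < n.+1) uu j).
Proof.
move=> lk; pose Z := \prod_(1 <= j < k) zz j; pose U := \prod_(k.+1 <= j < n.+1) uu j.
have hZ : hom (k - 1) Z by apply: hom_prod_zz => //; lia.
have hU : hom (n.+1 - k.+1) U by apply: hom_prod_uu_nat.
pose h i := phi (Z * uu i * U).
have hn : h n.+1 = 0.
  rewrite /h (_ : Z * _ * U = uu n.+1 * (Z * U)); last by ring.
  by apply: phi_un (homM hZ hU) _; lia.
have hrec i : (k < i <= n)%N -> (1 + q) * h i = q * h i.-1 + h i.+1.
  move=> ki; have [U' [hU' eU]] : exists U', hom (n - k.+1) U' /\ U = uu i * U'.
    exists (\prod_(k.+1 <= j < i) uu j * \prod_(i.+1 <= j < n.+1) uu j); split.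
      have -> : (n - k.+1 = (i - k.+1) + (n.+1 - i.+1))%N by lia.
      by apply: homM; apply: hom_prod_uu_nat; lia.
    rewrite /U (@big_cat_nat _ _ _ i) /=; try lia.
    by rewrite [X in _ * X]big_ltn; [ring|lia].
  have : phi (uu i * zz i * (Z * U')) = 0.
    by apply: phi_uz (homM hZ hU') _; lia.
  rewrite zzE; last by lia.
  have -> : uu i * ((1 + q) * uu i - q * uu i.-1 - uu i.+1) * (Z * U') =
    (1 + q) * (Z * uu i * U) - q * (Z * uu i.-1 * U) - Z * uu i.+1 * U by rewrite eU; ring.
  rewrite !phiB (phiZ _ invar_1Dq) (phiZ _ invar_q) => e0.
  by apply/eqP; rewrite -subr_eq0; apply/eqP; rewrite -e0 /h; ring.
have e t : (t < n.+1 - k)%N ->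
    (1 - q ^+ t.+1) * h (n.+1 - t)%N = q * (1 - q ^+ t) * h (n.+1 - t.+1)%N.
  elim: t => [|t IH] ht; first by rewrite subn0 hn expr0 subrr !(mulr0, mul0r).
  have e2 : q * h (n.+1 - t.+2)%N = (1 + q) * h (n.+1 - t.+1)%N - h (n.+1 - t)%N.
    rewrite hrec; last by lia.
    have -> : (n.+1 - t.+1).-1 = (n.+1 - t.+2)%N by lia.
    have -> : (n.+1 - t.+1).+1 = (n.+1 - t)%N by lia.
    by rewrite addrK.
  transitivity ((1 - q ^+ t.+1) * (q * h (n.+1 - t.+2)%N)); last by ring.
  rewrite e2 mulrBr IH; last by lia.
  by rewrite !exprS; ring.
have -> : \prod_(k <= j < n.+1) uu j = uu k * U by rewrite big_ltn //; lia.
rewrite big_nat_recr /=; last by lia.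
rewrite -/Z -/U mulrA -/(h k).
have hz : phi (Z * uu k.-1 * U) = 0.
  case: k lk @Z @U hZ hU @h hn hrec e => // -[|k] lk Z U hZ hU h hn hrec e.
    by rewrite uu0 mulr0 mul0r phi0.
  rewrite /Z big_nat_recr //=; set Z' := \prod_(_ <= _ < _) _.
  have hZ' : hom (k.+1 - 1) Z' by apply: hom_prod_zz => //; lia.
  rewrite (_ : _ * U = uu k.+1 * zz k.+1 * (Z' * U)); last by ring.
  by apply: phi_uz (homM hZ' hU) _; lia.
rewrite zzE; last by lia.
have -> : Z * ((1 + q) * uu k - q * uu k.-1 - uu k.+1) * U =
    (1 + q) * (Z * uu k * U) - q * (Z * uu k.-1 * U) - Z * uu k.+1 * U by ring.
rewrite !phiB (phiZ _ invar_1Dq) (phiZ _ invar_q).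
rewrite hz -!/(h _); have := e (n - k)%N; have -> : (n.+1 - (n - k) = k.+1)%N by lia.
have -> : ((n - k).+1 = n.+1 - k)%N by lia.
have -> : (n.+1 - (n.+1 - k) = k)%N by lia.
have -> : (n.+2 - k = (n - k).+2)%N by lia.
have -> : (n.+1 - k = (n - k).+1)%N by lia.
move=> /(_ _) e1; rewrite mulr0 subr0 mulrBr e1; last by lia.
by rewrite !exprS; ring.
Qed.

(** Telescoping replaces the u_j by z_j one at a time until phi is known to be [poinc]. The
    remaining factor is (1 - q^(n+1)) / (1 - q), so the value at u_1 .. u_n is [n]_q!. *)
Lemma phi_prod_uu : qfact_inv q n * phi (\prod_(1 <= j < n.+1) uu j) = 1.
Proof.
have step k : (k <= n)%N ->
    (1 - q ^+ (n.+1 - k)) * phi (\prod_(1 <= j < k.+1) zz j * \prod_(k.+1 <= j < n.+1) uu j)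
    = (1 - q ^+ n.+1) * phi (\prod_(1 <= j < n.+1) uu j).
  elim: k => [|k IH] kn; first by rewrite subn0 big_geq // mul1r.
  by rewrite phi_telescope ?subSS; [apply: IH|]; lia.
have := step n (leqnn n); rewrite subSnn [\prod_(n.+1 <= _ < _) _]big_geq // mulr1 phi_prodz expr1 => e.
have := sum_len q n.+1; rewrite -/(poinc) big_nat_recr //= [(1 - q) ^+ n.+1]exprS.
rewrite /qfact_inv; move: e; set C := phi _; set Q := \prod_(_ <= _ < _) _.
have Q0 : Q != 0.
  by rewrite prodf_seq_neq0; apply/allP => i; rewrite mem_index_iota => /andP[i0 _]; rewrite q_gen.
move: ((1 - q) ^+ n) => a e h.
rewrite mulrAC (_ : a * C = Q) ?divff //.
apply: (mulfI (q_gen (s := S) (ltn0Sn n))); rewrite mulrCA -e [RHS]mulrC -h.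
by ring.
Qed.

Local Notation N := n.+1.

(** ** The cyclic sum rule *)

(** From a zero i to the next zero i + m + 1, which exists by periodicity, the recurrence gives (1 -
    q) d(i + t) = (1 - q^t) d(i + 1). At the next zero this forces d(i + 1) = 0, so zeros propagate
    around the cycle. *)
Lemma gambler_ruin (d : nat -> F) : (forall i, d (i + N)%N = d i) ->
  (forall i, d i.+1 = 0 \/ (1 + q) * d i.+1 = q * d i + d i.+2) ->
  (exists i, d i = 0) -> forall i, d i = 0.
Proof.
move=> per rec [i0 di0].
have step i : d i = 0 -> d i.+1 = 0.
  move=> di; have ex : exists m, d (i + m.+1)%N == 0 by exists n; rewrite per di.
  case: (ex_minnP ex) => m /eqP dm mmin.
  have e t : (t <= m)%N -> (1 - q ^+ t.+1) * d i.+1 = (1 - q) * d (i + t.+1)%N /\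
      (1 - q ^+ t) * d i.+1 = (1 - q) * d (i + t)%N.
    elim: t => [|t IH] tm; first by rewrite expr0 subrr mul0r addn0 di mulr0 expr1 addn1.
    have [e1 e2] := IH (ltnW tm); split=> //.
    case: (rec (i + t)%N) => h.
      by have := mmin t; rewrite addnS h eqxx => /(_ isT); lia.
    rewrite !addnS in e1 h *.
    transitivity ((1 - q) * ((1 + q) * d (i + t).+1 - q * d (i + t)%N)).
      rewrite mulrBr [(1 - q) * (q * _)]mulrCA -e2 [(1 - q) * _]mulrCA -e1 !exprS.
      by ring.
    by rewrite h [q * _ + _]addrC addrK.
  have [+ _] := e m (leqnn m); rewrite dm mulr0 => /eqP.
  by rewrite mulf_eq0 (negPf (q_gen (s := S) (ltn0Sn m))) => /eqP.
have up m : d (i0 + m)%N = 0.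
  by elim: m => [|m IH]; rewrite ?addn0 // addnS step.
move=> i; have perm m j : d (j + m * N)%N = d j.
  by elim: m => [|m IH]; rewrite ?addn0 // mulSnr addnA per.
rewrite -(perm i0 i) (_ : i + i0 * N = i0 + (i + i0 * n))%N //.
by rewrite mulnS; lia.
Qed.

(* The letters are read modulo n + 1; the letter 0 contributes [uu 0 = 0]. *)
Definition Psi (a : seq nat) : F := \sum_(m < N) phi (\prod_(t <- a) uu (cshift n m t)).

Lemma cshift_lt m a : (cshift n m a < N)%N.
Proof. exact: ltn_pmod. Qed.

Lemma cshiftS m a : cshift n m a.+1 = if cshift n m a == n then 0%N else (cshift n m a).+1.
Proof.
rewrite /cshift addSn -addn1 -modnDml addn1; case: eqP => [->|/eqP h]; first exact: modnn.
by rewrite modn_small // ltnS ltn_neqAle h -ltnS ltn_pmod.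
Qed.

Lemma cshift_eq0 m a : (m < N)%N -> (a < N)%N -> (cshift n m a == 0%N) = (a == m).
Proof.
move=> mN aN; rewrite /cshift; case: (leqP m a) => ma.
  have -> : (a + (N - m) = (a - m) + N)%N by lia.
  by rewrite modnDr modn_small; lia.
by rewrite modn_small; lia.
Qed.

Lemma hom_prod_cshift m a : hom (size a) (\prod_(t <- a) uu (cshift n m t)).
Proof.
rewrite -(size_map (cshift n m)) -(big_map (cshift n m) predT uu); apply: hom_prod_uu.
by apply/allP => _ /mapP[t _ ->]; have := cshift_lt m t; lia.
Qed.

Lemma Psi_perm a b : perm_eq a b -> Psi a = Psi b.
Proof. by move=> ab; apply: eq_bigr => m _; congr phi; exact: perm_big. Qed.

Lemma Psi_mod i c : Psi ((i %% N)%N :: c) = Psi (i :: c).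
Proof. by apply: eq_bigr => m _; rewrite !big_cons /cshift modnDml. Qed.

(** For each shift this is the relation u_r z_r = 0, with r the shifted value of i + 1. At r = 0
    every term contains u_0 = 0; at r = n the wrapped factor u_0 stands in for u_(n+1), which phi
    kills as well. *)
Lemma Psi_rec i t c : (size c).+2 = n -> (t = i.+1 %[mod N])%N ->
  (1 + q) * Psi (i.+1 :: t :: c) = q * Psi (i :: t :: c) + Psi (i.+2 :: t :: c).
Proof.
move=> sc ti; rewrite /Psi !big_distrr -big_split; apply: eq_bigr => m _ /=.
have et : cshift n m t = cshift n m i.+1 by rewrite /cshift -modnDml ti modnDml.
rewrite !big_cons et; have hR := hom_prod_cshift m c; move: (\prod_(_ <- c) _) hR => R hR.
have := cshift_lt m i.+1; rewrite (cshiftS m i.+1); move e : (cshift n m i.+1) => r rN.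
have ei : (r = 0%N) \/ (cshift n m i = r.-1).
  by move: e; rewrite cshiftS; case: eqP => _ <-; [left|right].
case: ei => [->|ei]; first by rewrite uu0 !(mul0r, mulr0, phi0, addr0).
case: (posnP r) => [->|r0]; first by rewrite uu0 !(mul0r, mulr0, phi0, addr0).
have lr : letter r by lia.
have -> : phi (uu (if r == n then 0%N else r.+1) * (uu r * R)) = phi (uu r.+1 * (uu r * R)).
  case: eqP => // ern; rewrite uu0 mul0r phi0.
  have hu : hom 1 (uu r) by apply: hom_uu; lia.
  have er : r.+1 = n.+1 by rewrite ern.
  by rewrite er (phi_un (homM hu hR)) //; lia.
rewrite ei; have := phi_uz lr hR sc; rewrite zzE; last by lia.
have -> : uu r * ((1 + q) * uu r - q * uu r.-1 - uu r.+1) * R =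
    (1 + q) * (uu r * (uu r * R)) - q * (uu r.-1 * (uu r * R)) - uu r.+1 * (uu r * R) by ring.
rewrite !phiB (phiZ _ invar_1Dq) (phiZ _ invar_q) => e0.
by apply/eqP; rewrite -subr_eq0; apply/eqP; rewrite -e0; ring.
Qed.

(** c misses exactly one residue j0. A shift by m other than j0 sends a letter of c to 0, and the
    shift by j0 sends c to a rearrangement of 1, .., n. *)
Lemma Psi_squarefree (c : seq nat) : uniq c -> all (fun t => (t < N)%N) c -> size c = n ->
  Psi c = phi (\prod_(1 <= j < N) uu j).
Proof.
move=> uc lc sc.
have [j0 jN jc] : exists2 j0, (j0 < N)%N & j0 \notin c.
  have : ~~ (all (mem c) (iota 0 N)).
    apply/negP => /allP h; have := uniq_leq_size (iota_uniq 0 N) h.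
    by rewrite size_iota sc ltnn.
  by rewrite -has_predC => /hasP[j0]; rewrite mem_iota; exists j0.
rewrite /Psi (bigD1 (Ordinal jN)) //= [X in _ + X]big1 ?addr0; last first.
  move=> m /eqP mj; have mc : nat_of_ord m \in c.
    apply: contraT => mc; have : ((size (j0 :: nat_of_ord m :: c)) <= N)%N.
      rewrite -[N in (_ <= N)%N](size_iota 0 N); apply: uniq_leq_size.
        rewrite /= inE negb_or jc mc uc !andbT.
        by apply/eqP => e; apply: mj; apply: val_inj.
      by move=> t; rewrite !inE mem_iota => /or3P[/eqP->|/eqP->|/(allP lc) /=];
        have := ltn_ord m; lia.
    by rewrite /= sc; lia.
  rewrite (big_rem _ mc) /= (_ : cshift n m m = 0%N) ?uu0 ?mul0r ?phi0 //.
  by apply/eqP; rewrite cshift_eq0.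
congr phi; rewrite -(big_map (cshift n j0) predT uu) /index_iota subn1.
have inj : {in c &, injective (cshift n j0)}.
  move=> a b ac bc; rewrite /cshift => /eqP; rewrite eqn_modDr !modn_small; first by move/eqP.
    exact: (allP lc).
  exact: (allP lc).
apply: perm_big; apply: uniq_perm.
- by rewrite map_inj_in_uniq.
- exact: iota_uniq.
have sub : {subset map (cshift n j0) c <= iota 1 N.-1}.
  move=> _ /mapP[a ac ->]; rewrite mem_iota add1n cshift_lt andbT lt0n cshift_eq0 //.
    by apply: contraNneq jc => <-.
  exact: (allP lc).
have ui : uniq (map (cshift n j0) c) by rewrite map_inj_in_uniq.
have [] := uniq_min_size ui sub; first by rewrite size_iota size_map sc.
by [].
Qed.

(** In [key], c holds distinct letters and r those still to be treated. As a function of a further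
    letter k, the difference to C vanishes for k outside c by induction and is harmonic at the
    points of c. Since c misses some residue, [gambler_ruin] makes it zero everywhere. *)
Lemma PsiE a : size a = n -> Psi a = phi (\prod_(1 <= j < N) uu j).
Proof.
set C := phi _ => sa.
suff key (r : seq nat) : forall c : seq nat, uniq c -> all (fun t => (t < N)%N) c -> (size c + size r)%N = n ->
    Psi (c ++ r) = C.
  by apply: (key a [::]).
elim: r => [|i r IH] c uc lc sc.
  by rewrite cats0; apply: Psi_squarefree => //; move: sc; rewrite addn0.
rewrite /= in sc.
have -> : Psi (c ++ i :: r) = Psi (i :: c ++ r).
  by apply: Psi_perm; rewrite -cat_rcons perm_sym -cat_cons perm_cat2r perm_sym perm_rcons.
suff : forall k, Psi (k :: c ++ r) - C = 0 by move=> /(_ i)/eqP; rewrite subr_eq0 => /eqP.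
have out k : (k %% N)%N \notin c -> Psi (k :: c ++ r) - C = 0.
  move=> kc; rewrite -Psi_mod -cat_cons IH ?subrr //=; first by rewrite kc.
    by rewrite ltn_pmod.
  by rewrite -sc; lia.
apply: gambler_ruin => [k|k|].
- by rewrite -Psi_mod modnDr Psi_mod.
- case: (boolP ((k.+1 %% N)%N \in c)) => kc; last by left; apply: out.
  right.
  have pe j : Psi (j :: c ++ r) = Psi (j :: (k.+1 %% N)%N :: (rem (k.+1 %% N)%N c ++ r)).
    by apply: Psi_perm; rewrite perm_cons -cat_cons perm_cat2r perm_to_rem.
  have := @Psi_rec k (k.+1 %% N)%N (rem (k.+1 %% N)%N c ++ r).
  rewrite -!pe modn_mod => /(_ _ erefl) e.
  rewrite !mulrBr e; first by ring.
  by rewrite size_cat size_rem //; case: (c) kc sc => //= *; lia.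
have [j0 jN jc] : exists2 j0, (j0 < N)%N & j0 \notin c.
  have : ~~ (all (mem c) (iota 0 N)).
    apply/negP => /allP h; have := uniq_leq_size (iota_uniq 0 N) h.
    by rewrite size_iota; move: sc; by move: (size c) (size r) => u v; lia.
  by rewrite -has_predC => /hasP[j0]; rewrite mem_iota; exists j0.
by exists j0; apply: out; rewrite modn_small.
Qed.

Lemma qfact_inv_Psi a : size a = n -> qfact_inv q n * Psi a = 1.
Proof. by move=> /PsiE ->; exact: phi_prod_uu. Qed.

End DividedSymmetrization.

(** * Rational functions *)

Lemma subf_div (F : fieldType) (a b c d : F) : b != 0 -> d != 0 ->
  a / b - c / d = (a * d - c * b) / (b * d).
Proof. by move=> b0 d0; field; rewrite b0 d0. Qed.

Section FractionMap.
Local Open Scope quotient_scope.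
Import FracField.
Variable R : idomainType.
Local Notation tofrac := (@FracField.tofrac R).

Lemma tofrac_pi (r : {ratio R}) : tofrac (frac r).1 / tofrac (frac r).2 = \pi_{fraction R} r.
Proof.
have d0 : tofrac (frac r).2 != 0 by rewrite tofrac_eq0 denom_ratioP.
apply: (mulIf d0); rewrite divfK //; unlock tofrac; rewrite -[RHS]pi_mul.
apply/eqmodP; rewrite /= equivfE /mulf !numden_Ratio ?(mulf_neq0, oner_neq0, denom_ratioP) //.
by rewrite !mulr1 mul1r mulrC.
Qed.

Lemma fracE (g : {fraction R}) :
  tofrac (frac (repr g)).1 / tofrac (frac (repr g)).2 = g.
Proof. by rewrite tofrac_pi reprK. Qed.

Lemma frac_split (g : {fraction R}) :
  exists a b, b != 0 /\ g = tofrac a / tofrac b.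
Proof.
exists (frac (repr g)).1, (frac (repr g)).2.
by rewrite fracE denom_ratioP.
Qed.

Variable f : {rmorphism R -> R}.
Hypothesis f_inj : injective f.

(** Computed on the chosen representative, in the same form as [sK], so that the two agree as soon
    as the maps on polynomials do. *)
Definition fracmap (g : {fraction R}) : {fraction R} :=
  tofrac (f (frac (repr g)).1) / tofrac (f (frac (repr g)).2).

Lemma f_neq0 a : a != 0 -> tofrac (f a) != 0.
Proof. by move=> a0; rewrite tofrac_eq0 -(rmorph0 f) (inj_eq f_inj). Qed.

Lemma fracmap_wd a b c d : b != 0 -> d != 0 -> tofrac c / tofrac d = tofrac a / tofrac b ->
  tofrac (f c) / tofrac (f d) = tofrac (f a) / tofrac (f b).
Proof.
move=> b0 d0 /eqP; rewrite eqr_div ?tofrac_eq0 // -!tofracM tofrac_eq.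
move=> /eqP/(congr1 f); rewrite !rmorphM => e.
by apply/eqP; rewrite eqr_div ?f_neq0 // -!tofracM e.
Qed.

Lemma fracmap_div a b : b != 0 -> fracmap (tofrac a / tofrac b) = tofrac (f a) / tofrac (f b).
Proof. by move=> b0; apply: fracmap_wd => //; [exact: denom_ratioP|exact: fracE]. Qed.

Lemma fracmap_tofrac a : fracmap (tofrac a) = tofrac (f a).
Proof. by rewrite -[tofrac a]divr1 -tofrac1 fracmap_div ?oner_eq0 // rmorph1 tofrac1 !divr1. Qed.

Lemma fracmap_is_zmod_morphism : zmod_morphism fracmap.
Proof.
move=> g h; have [a [b [b0 ->]]] := frac_split g; have [c [d [d0 ->]]] := frac_split h.
have [tb td] : tofrac b != 0 /\ tofrac d != 0 by rewrite !tofrac_eq0.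
rewrite [X in fracmap X]subf_div // -!tofracM -tofracB !fracmap_div ?mulf_neq0 //.
by rewrite subf_div ?f_neq0 // !rmorphB !rmorphM.
Qed.

Lemma fracmap_is_monoid_morphism : monoid_morphism fracmap.
Proof.
split=> [|g h]; first by rewrite -tofrac1 fracmap_tofrac rmorph1.
have [a [b [b0 ->]]] := frac_split g; have [c [d [d0 ->]]] := frac_split h.
rewrite mulrACA -invfM -!tofracM !fracmap_div ?mulf_neq0 //.
by rewrite !rmorphM invfM mulrACA.
Qed.

HB.instance Definition _ := GRing.isZmodMorphism.Build _ _ fracmap fracmap_is_zmod_morphism.
HB.instance Definition _ := GRing.isMonoidMorphism.Build _ _ fracmap fracmap_is_monoid_morphism.

Definition fracmap_rmorphism : {rmorphism {fraction R} -> {fraction R}} := fracmap.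

End FractionMap.

Section RationalFunctions.
Variable n : nat.
Local Notation N := n.+1.
Local Notation letter i := (0 < i < n.+1)%N.

(** The fixed last variable is q. *)
Definition ext (u : 'S_N) : 'S_N.+1 := lift_perm ord_max ord_max u.

Lemma ext_val u k : (k < N)%N -> ext u (inord k) = u (inord k) :> nat.
Proof.
move=> kN; have -> : (inord k : 'I_N.+1) = lift ord_max (inord k : 'I_N).
  by apply: val_inj; rewrite /= /bump !inordK //; lia.
by rewrite lift_perm_lift /= /bump leqNgt ltn_ord.
Qed.

Lemma ext_max u : ext u ord_max = ord_max.
Proof. exact: lift_perm_id. Qed.

Definition polact (u : 'S_N) : {rmorphism Pol N -> Pol N} := @msym N.+1 rat (ext u).

Lemma polact_inj u : injective (polact u).
Proof. exact: inj_msym. Qed.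

Definition Kact (u : 'S_N) : {rmorphism K N -> K N} := fracmap_rmorphism (@polact_inj u).

Lemma KactE u a b : b != 0 -> Kact u (FracField.tofrac a / FracField.tofrac b) =
  FracField.tofrac (polact u a) / FracField.tofrac (polact u b).
Proof. by move=> b0; apply: (fracmap_div (@polact_inj u)). Qed.

Lemma Kact1 g : Kact 1%g g = g.
Proof.
have [a [b [b0 ->]]] := frac_split g.
by rewrite KactE // /= /ext lift_perm1 !msym1m.
Qed.

Lemma KactM u v g : Kact (u * v)%g g = Kact v (Kact u g).
Proof.
have [a [b [b0 ->]]] := frac_split g.
rewrite [Kact u _]KactE // !KactE //.
  by rewrite /= /ext -(@lift_permM _ ord_max ord_max ord_max) !msymMm.
by rewrite -(rmorph0 (polact u)) (inj_eq (@polact_inj u)).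
Qed.

Lemma polact_X u (i : 'I_N.+1) : polact u 'X_i = 'X_(ext u i).
Proof. by rewrite /= /msym mmapX mmap1U. Qed.

Lemma Kact_x u k : (k < N)%N -> Kact u (xK N k.+1) = xK N (u (inord k)).+1.
Proof.
move=> kN; rewrite /xK [LHS]fracmap_tofrac; last exact: polact_inj.
rewrite polact_X; congr (FracField.tofrac 'X_ _); apply: val_inj.
by rewrite /= ext_val // inordK // ltnW // ltnS ltn_ord.
Qed.

Lemma inord_max_q : (inord N : 'I_N.+1) = ord_max.
Proof. by apply: val_inj; rewrite /= inordK. Qed.

Lemma Kact_q u : Kact u (qK N) = qK N.
Proof.
rewrite [LHS]fracmap_tofrac; last exact: polact_inj.
by rewrite /qK; congr FracField.tofrac; rewrite /qP inord_max_q polact_X ext_max.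
Qed.

Lemma xK_neq i j : (0 < i <= N)%N -> (0 < j <= N)%N -> i != j -> xK N i - xK N j != 0.
Proof.
move=> hi hj ij; rewrite subr_eq0 tofrac_eq; apply: contra ij => /eqP e.
have := congr1 (mcoeff U_(inord j.-1)%MM) e; rewrite !mcoeffX eqxx eq_mnm1.
case: eqP => // /(congr1 val); rewrite /= !inordK; try lia.
Qed.

Lemma qxK_neq i j : (0 < i <= N)%N -> (0 < j <= N)%N -> i != j -> qK N * xK N i - xK N j != 0.
Proof.
move=> hi hj ij; rewrite subr_eq0 -tofracM tofrac_eq; apply/eqP => e.
have := congr1 (mcoeff U_(inord j.-1)%MM) e; rewrite -mpolyXD !mcoeffX eqxx.
case: eqP => // /(congr1 mdeg); rewrite mdegD !mdeg1 //.
Qed.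

Lemma qK_gen m : (0 < m)%N -> 1 - qK N ^+ m != 0.
Proof.
move=> m0; rewrite subr_eq0 -tofrac1 -tofracXn tofrac_eq; apply/eqP => e.
have := congr1 (mcoeff 0%MM) e; rewrite mcoeff1 eqxx /qP mpolyXn mcoeffX.
case: eqP => // /(congr1 mdeg); rewrite mdegMn mdeg1 mdeg0 mul1n => h.
by rewrite h in m0.
Qed.

Lemma factK_neq0 : (N`!)%:R != 0 :> K N.
Proof.
rewrite -tofrac1 -tofracMn tofrac_eq0 -(mpolyC_nat _ _ N`!) mpolyC_eq0.
by rewrite Num.Theory.pnatr_eq0 -lt0n fact_gt0.
Qed.

Definition KS : symfield n (K N) :=
  SymField Kact1 KactM Kact_x Kact_q xK_neq qxK_neq qK_gen factK_neq0.

Lemma sKE i g : letter i -> sK i g = sact KS (sperm N i) g.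
Proof.
move=> li; rewrite /sK /= /fracmap /polact /=.
have e p : sP i p = msym (ext (sperm N i)) p.
  rewrite /sP /comp_mpoly /msym /mmap; apply: eq_bigr => m _; congr (_ * _).
  apply: mmap1_eq => k; rewrite tnth_mktuple; congr 'X_ _; apply: val_inj.
  have [->|kN] := eqVneq k ord_max.
    by rewrite ext_max /swap_idx /= !ifN //; apply/eqP; lia.
  have {}kN : (k < N)%N by move: kN; have := ltn_ord k; rewrite -val_eqE /=; lia.
  rewrite -[k in RHS]inord_val [RHS](ext_val _ kN) sperm_val // /swap_idx inordK //=.
  by split_ifs; rewrite ?inordK //; lia.
by rewrite !e.
Qed.

Lemma ddKE i g : letter i -> ddK i g = dd KS i g.
Proof. by move=> li; rewrite /ddK sKE. Qed.

Lemma TKE i g : letter i -> TK i g = Tq KS i g.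
Proof. by move=> li; rewrite /TK ddKE // sKE. Qed.

Lemma TwE (w : 'S_N) g : @Tw N N w g = Tqw KS w g.
Proof.
rewrite /Tw /Tqw; have := red_letters (head_Red w).
elim: (head _ _) => //= i a IH /andP[li la].
by rewrite IH // TKE.
Qed.

Lemma qdivsymE f : @qdivsym N N f = phi KS f.
Proof. by rewrite /qdivsym /phi /Tqall; apply: eq_bigr => w _; rewrite TwE. Qed.

Lemma schubE (w : 'S_N) : @schub N N w = schubert KS w.
Proof.
rewrite /schub /schubert; have := red_letters (head_Red (w * w0 N)%g).
move: (\prod_(_ <= _ < _) _); elim: (head _ _) => //= i a IH g /andP[li la].
by rewrite ddKE // IH.
Qed.

Lemma a_E (w : 'S_N) : len w = n -> a_ N w =
  qfact_inv (qK N) n * \sum_(a <- Red w) qK N ^+ comaj a * phi KS (\prod_(i <- a) uu KS i).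
Proof. by move=> lw; rewrite /a_ qdivsymE schubE phi_schubert. Qed.

End RationalFunctions.

(** * Cyclic shifts *)

Section Rotation.
Variable n : nat.
Local Notation N := n.+1.
Local Notation s := (sperm N).
Local Notation letter i := (0 < i < n.+1)%N.
Implicit Types (w : 'S_N) (a : seq nat).

Definition cshift_ord m (k : 'I_N) : 'I_N := inord (cshift n m k).

Lemma cshift_inj m : {in [pred k | k < N]%N &, injective (cshift n m)}.
Proof.
by move=> k l kN lN /eqP; rewrite /cshift eqn_modDr !modn_small // => /eqP.
Qed.

Lemma cshift_ord_inj m : injective (cshift_ord m).
Proof.
move=> k l /(congr1 val); rewrite /= !inordK ?cshift_lt // => e.
by apply: val_inj; apply: cshift_inj e; exact: ltn_ord.
Qed.

Definition cshift_perm m : 'S_N := perm (@cshift_ord_inj m).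

Lemma cshift_perm_inord m k : (k < N)%N -> cshift_perm m (inord k) = inord (cshift n m k).
Proof. by move=> kN; rewrite permE /cshift_ord inordK. Qed.

Lemma cshift_letter m i : (m < N)%N -> letter i -> i != m -> letter (cshift n m i).
Proof.
move=> mN li im; rewrite cshift_lt andbT lt0n cshift_eq0 //; lia.
Qed.

(** Rotation keeps the positions i-1 and i adjacent unless the cut falls between them, which is the
    case i = m. *)
Lemma sperm_cshift m i : (m < N)%N -> letter i -> i != m ->
  (s i ^ cshift_perm m)%g = s (cshift n m i).
Proof.
move=> mN li im; rewrite /sperm tpermJ !cshift_perm_inord; try lia.
have := cshift_letter mN li im; case: i li im => // i li im; rewrite cshiftS.
by case: eqP.
Qed.

Lemma word_perm_cshift m a : (m < N)%N -> letters n a -> m \notin a ->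
  word_perm N (map (cshift n m) a) = (word_perm N a ^ cshift_perm m)%g.
Proof.
move=> mN; elim: a => [|i a IH] /=; first by rewrite conj1g.
case/andP=> li la; rewrite inE negb_or eq_sym => /andP[im ma].
by rewrite IH // conjMg sperm_cshift.
Qed.

Lemma letters_cshift m a : (m < N)%N -> letters n a -> m \notin a -> letters n (map (cshift n m) a).
Proof.
move=> mN; elim: a => [|i a IH] //= /andP[li la].
by rewrite inE negb_or eq_sym => /andP[im ma]; rewrite cshift_letter // IH.
Qed.

Lemma stab_red_le m w a : (m < N)%N -> stab m w -> reduced w a -> m \notin a.
Proof.
case: m => [|m] mN sw ra; last exact: stab_red sw ra.
by apply/negP => /(allP (red_letters ra)).
Qed.

Lemma len_cshift_le m w : (m < N)%N -> stab m w -> (len (w ^ cshift_perm m)%g <= len w)%N.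
Proof.
move=> mN sw; case: (red_ex w) => a ra; have ma := stab_red_le mN sw ra.
rewrite -(red_size ra) -(red_wp ra) -word_perm_cshift ?(red_letters ra) //.
rewrite -(size_map (cshift n m)); apply: len_wp.
by rewrite letters_cshift ?(red_letters ra).
Qed.

Lemma cshiftK m k : (0 < m < N)%N -> (k < N)%N -> cshift n (N - m) (cshift n m k) = k.
Proof.
move=> mN kN; rewrite /cshift modnDml.
have -> : (k + (N - m) + (N - (N - m)) = k + N)%N by lia.
by rewrite modnDr modn_small.
Qed.

Lemma cshift_permK m : (0 < m < N)%N -> (cshift_perm m * cshift_perm (N - m))%g = 1%g.
Proof.
move=> mN; apply/permP => k; rewrite permM -[k]inord_val perm1 cshift_perm_inord ?ltn_ord //.
by rewrite cshift_perm_inord ?cshift_lt // cshiftK ?ltn_ord.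
Qed.

Lemma stab_cshift m w : (0 < m < N)%N -> stab m w -> stab (N - m) (w ^ cshift_perm m)%g.
Proof.
move=> mN sw k km.
have -> : inord k = cshift_perm m (inord (k + m)).
  rewrite cshift_perm_inord; last by lia.
  congr inord; rewrite /cshift; have -> : (k + m + (N - m) = k + N)%N by lia.
  by rewrite modnDr modn_small //; lia.
rewrite permJ -[w _]inord_val cshift_perm_inord ?ltn_ord // inordK ?cshift_lt //.
have h1 := stab_ge (k := (k + m)%N) sw; have h2 := ltn_ord (w (inord (k + m))).
rewrite /cshift; have -> : (w (inord (k + m)) + (N - m) = (w (inord (k + m)) - m) + N)%N by lia.
by rewrite modnDr modn_small; lia.
Qed.

(** Renaming a reduced word gives one inequality, and rotating back by N - m the other. The rotation
    by m = 0 is treated apart, as N - m is then out of range. *)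
Lemma len_cshift m w : (m < N)%N -> stab m w -> len (w ^ cshift_perm m)%g = len w.
Proof.
move=> mN sw; case: (posnP m) => [->|m0].
  have -> : cshift_perm 0 = 1%g.
    apply/permP => k; rewrite perm1 -[k]inord_val cshift_perm_inord ?ltn_ord // /cshift.
    by rewrite subn0 modnDr modn_small ?ltn_ord.
  by rewrite conjg1.
apply/eqP; rewrite eqn_leq len_cshift_le //=.
have hm : (0 < m < N)%N by rewrite m0.
have hm' : (N - m < N)%N by lia.
have := len_cshift_le hm' (stab_cshift hm sw).
by rewrite -conjgM cshift_permK // conjg1.
Qed.

Lemma red_cshift m w a : (m < N)%N -> stab m w -> reduced w a ->
  reduced (w ^ cshift_perm m)%g (map (cshift n m) a).
Proof.
move=> mN sw ra; have ma := stab_red_le mN sw ra; have la := red_letters ra.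
apply/and3P; split; first exact: letters_cshift.
  by rewrite word_perm_cshift // (red_wp ra).
by rewrite size_map len_cshift // (red_size ra).
Qed.

Lemma perm_Red_cshift m w : (m < N)%N -> stab m w ->
  perm_eq (Red (w ^ cshift_perm m)%g) (map (map (cshift n m)) (Red w)).
Proof.
move=> mN sw; case: (posnP m) => [m0|m0].
  have e a : letters n a -> map (cshift n 0) a = a.
    elim: a => //= i a IH /andP[li la]; rewrite IH // /cshift subn0 modnDr modn_small //; lia.
  have -> : cshift_perm m = 1%g.
    apply/permP => k; rewrite perm1 -[k]inord_val cshift_perm_inord ?ltn_ord // /cshift m0.
    by rewrite subn0 modnDr modn_small ?ltn_ord.
  rewrite conjg1 m0 (_ : map _ _ = Red w) //.
  by rewrite -[RHS]map_id; apply/eq_in_map => a; rewrite mem_Red => /red_letters/e.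
have hm : (0 < m < N)%N by rewrite m0.
have hm' : (N - m < N)%N by lia.
have mapK a : letters n a -> map (cshift n (N - m)) (map (cshift n m) a) = a.
  by elim: a => //= i a IH /andP[li la]; rewrite IH // cshiftK //; lia.
have mapK' a : letters n a -> map (cshift n m) (map (cshift n (N - m)) a) = a.
  elim: a => //= i a IH /andP[li la]; rewrite IH //.
  have := @cshiftK (N - m) i; rewrite subKn; last exact: ltnW.
  by move=> -> //; lia.
apply: uniq_perm; first exact: Red_uniq.
  rewrite map_inj_in_uniq ?Red_uniq // => a b; rewrite !mem_Red.
  by move=> /red_letters/mapK {2}<- /red_letters/mapK {2}<- ->.
move=> a; rewrite mem_Red; apply/idP/mapP => [ra|[b + ->]]; last first.
  by rewrite mem_Red; exact: red_cshift.
exists (map (cshift n (N - m)) a); last by rewrite mapK' // (red_letters ra).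
rewrite mem_Red -[w]conjg1 -(cshift_permK hm) conjgM.
by apply: red_cshift => //; exact: stab_cshift.
Qed.

(** The alphabet may omit letters that occur in no reduced word of w. In this way the letter m,
    which links the two blocks, is dropped before they are exchanged. *)
Lemma wordsum_red (F : fieldType) (q : F) (y : nat -> F) L r w :
  uniq L -> (forall i, i \in L -> letter i) ->
  (forall a, reduced w a -> all (mem L) a) ->
  wordsum q (@red_step n) (fun t => (t == Some 1%g)%:R) y L r (len w) (Some w) =
  \sum_(a <- Red w) q ^+ comajr r a * \prod_(i <- a) y i.
Proof.
move=> uL lL hL; rewrite /wordsum.
transitivity (\sum_(a <- wordsL L (len w) | reduced w a) q ^+ comajr r a * \prod_(i <- a) y i).
  rewrite [RHS]big_mkcond big_seq [RHS]big_seq; apply: eq_bigr => a.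
  rewrite mem_wordsL => /andP[_ aL].
  rewrite foldr_red_step; last by apply: sub_all aL => i /lL.
  by case: (reduced w a); rewrite ?mulr1 ?mulr0.
rewrite -big_filter; apply: perm_big; apply: uniq_perm.
- by apply/filter_uniq/wordsL_uniq.
- exact: Red_uniq.
move=> a; rewrite mem_Red mem_filter andb_idr // => ra.
by rewrite mem_wordsL (red_size ra) eqxx hL.
Qed.

Lemma pairwise_two_iota i0 j0 k l : (i0 + k <= j0)%N ->
  pairwise ltn (iota i0 k ++ iota j0 l).
Proof.
move=> ij0; have pi i m : pairwise ltn (iota i m).
  by rewrite -(sorted_pairwise ltn_trans) iota_ltn_sorted.
rewrite pairwise_cat !pi !andbT; apply/allrelP => i j; rewrite !mem_iota /=; lia.
Qed.

(** Without m, the letters below and above m form commuting blocks [s1] and [s2]. The rotation is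
    increasing on [s2 ++ s1], so comaj of the renamed words is comaj for that order of the alphabet,
    and [wordsum_swap] returns to the usual order. *)
Lemma sum_Red_cshift (F : fieldType) (q : F) (y : nat -> F) m w :
  (forall k, (0 < k)%N -> 1 - q ^+ k != 0) -> (m < N)%N -> stab m w ->
  \sum_(a <- Red (w ^ cshift_perm m)%g) q ^+ comaj a * \prod_(i <- a) y i =
  \sum_(a <- Red w) q ^+ comaj a * \prod_(i <- a) y (cshift n m i).
Proof.
move=> q_gen mN sw; rewrite (perm_big _ (perm_Red_cshift mN sw)) big_map.
pose s1 := iota 1 m.-1; pose s2 := iota m.+1 (n - m).
have mem1 i : (i \in s1) = (0 < i < m)%N by rewrite mem_iota; lia.
have mem2 i : (i \in s2) = (m < i < N)%N by rewrite mem_iota; lia.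
have lL i : i \in s1 ++ s2 -> letter i by rewrite mem_cat mem1 mem2; lia.
have lL' i : i \in s2 ++ s1 -> letter i by rewrite mem_cat mem1 mem2; lia.
have hL a : reduced w a -> all (mem (s1 ++ s2)) a.
  move=> ra; apply/allP => i ia /=; have := stab_red_le mN sw ra.
  have := allP (red_letters ra) i ia; rewrite mem_cat mem1 mem2.
  by case: (eqVneq i m) => [<-|]; [rewrite ia|lia].
have hL' a : reduced w a -> all (mem (s2 ++ s1)) a.
  by move/hL; apply: sub_all => i; rewrite !inE !mem_cat orbC.
have p1 : pairwise ltn (s1 ++ s2) by apply: pairwise_two_iota; lia.
have u1 : uniq (s1 ++ s2).
  by apply: (sorted_uniq ltn_trans ltnn); rewrite (sorted_pairwise ltn_trans).
have u2 : uniq (s2 ++ s1) by rewrite uniq_catC.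
have p2 : pairwise (fun i j => cshift n m i < cshift n m j)%N (s2 ++ s1).
  have : pairwise ltn (map (cshift n m) (s2 ++ s1)).
    rewrite map_cat.
    have -> : map (cshift n m) s2 = iota 1 (n - m).
      rewrite /s2 -[m.+1]addn1 iotaDl -map_comp -[RHS]map_id.
      apply/eq_in_map => k; rewrite mem_iota /= /cshift => hk.
      by rewrite (_ : m + k + (N - m) = k + N)%N ?modnDr ?modn_small; lia.
    have -> : map (cshift n m) s1 = iota ((N - m) + 1) m.-1.
      rewrite iotaDl; apply/eq_in_map => k; rewrite mem_iota /cshift => hk.
      by rewrite modn_small; lia.
    by apply: pairwise_two_iota; lia.
  by rewrite pairwise_map.
transitivity (wordsum q (@red_step n) (fun t => (t == Some 1%g)%:R) (fun i => y (cshift n m i))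
    (s2 ++ s1) (fun i j => cshift n m i < cshift n m j)%N (len w) (Some w)).
  rewrite wordsum_red //; apply: eq_bigr => a _.
  by rewrite comajr_map big_map.
rewrite -(@wordsum_swap _ _ _ _ _ None _ q_gen s1 s2 ltn) //.
- by rewrite wordsum_red.
- by move=> i t /lL li; exact: red_step2.
- by move=> i j t; rewrite mem1 mem2 => hi hj; rewrite (@red_step_comm n i j) //; lia.
- by apply: sub_pairwise p1 => i j /=; lia.
- by apply: sub_pairwise p2 => i j /=; lia.
Qed.

Local Notation S := (KS n).

Lemma a_cshift m w : (m < N)%N -> stab m w -> len w = n ->
  a_ N (w ^ cshift_perm m)%g =
  qfact_inv (qK N) n * \sum_(a <- Red w) qK N ^+ comaj a * phi S (\prod_(i <- a) uu S (cshift n m i)).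
Proof.
move=> mN sw lw; rewrite a_E ?len_cshift //; congr (_ * _).
have lin (r : seq (seq nat)) (y : nat -> K N) :
    \sum_(a <- r) qK N ^+ comaj a * phi S (\prod_(i <- a) y i) =
    phi S (\sum_(a <- r) qK N ^+ comaj a * \prod_(i <- a) y i).
  rewrite phi_sum; apply: eq_bigr => a _; rewrite phiZ //.
  exact: (invar_qX S).
by rewrite lin sum_Red_cshift ?lin // => k; exact: (q_gen (s := S)).
Qed.

End Rotation.

(** * Cross products *)

Local Notation SPmk m w := (existT (fun d : nat => 'S_d) m w).

(** A function on all naturals, the identity beyond the size, so that equalities between
    permutations of different index types can be checked pointwise. *)
Definition spval (z : SP) (k : nat) : nat :=
  if insub k is Some i then val (projT2 z i) else k.

Lemma spvalE m (w : 'S_m) k (km : (k < m)%N) : spval (SPmk m w) k = w (Ordinal km).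
Proof. by rewrite /spval insubT. Qed.

Lemma spval_ge z k : (projT1 z <= k)%N -> spval z k = k.
Proof. by move=> zk; rewrite /spval insubF // ltnNge zk. Qed.

Lemma spval_lt z k : (k < projT1 z)%N -> (spval z k < projT1 z)%N.
Proof. by case: z => m w km; rewrite spvalE. Qed.

Lemma spval_inj z k l : (k < projT1 z)%N -> (l < projT1 z)%N -> spval z k = spval z l -> k = l.
Proof. by case: z => m w km lm; rewrite !spvalE => /val_inj/perm_inj []. Qed.

Lemma spval_inord n (w : 'S_n.+1) k : (k < n.+1)%N -> spval (SPmk n.+1 w) k = w (inord k).
Proof.
by move=> kn; rewrite spvalE; congr (nat_of_ord (w _)); apply: val_inj; rewrite /= inordK.
Qed.

Lemma SP_ext z t : projT1 z = projT1 t -> spval z =1 spval t -> z = t.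
Proof.
case: z t => m w [m' w'] /= e; subst m' => h; congr existT.
apply/permP => -[k km]; apply: val_inj; have := h k.
by rewrite !spvalE.
Qed.

Lemma spval_cross z t k :
  spval (crossS z t) k = if (k < projT1 z)%N then spval z k else (projT1 z + spval t (k - projT1 z))%N.
Proof.
case: z t => a u [b v] /=; case: (ltnP k (a + b)) => kab; last first.
  rewrite !spval_ge //=; try lia.
  by rewrite ifN; lia.
rewrite /crossS /= spvalE permE /cross_fun.
case: splitP => [i|j] /= ->; first by rewrite ltn_ord spvalE; congr (nat_of_ord (u _)); apply: val_inj.
rewrite ltnNge leq_addr /= addKn spvalE; congr (_ + nat_of_ord (v _))%N; exact: val_inj.
Qed.

Definition unitS : SP := SPmk 0%N 1%g.

Lemma crossS0l z : crossS unitS z = z.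
Proof. by apply: SP_ext => // k; rewrite spval_cross /= subn0. Qed.

Lemma crossSA z t r : crossS (crossS z t) r = crossS z (crossS t r).
Proof.
apply: SP_ext => [|k]; first by rewrite /= addnA.
rewrite !spval_cross /=; case: (ltnP k (projT1 z)) => kz; first by rewrite ltn_addr // kz.
case: (ltnP k (projT1 z + projT1 t)) => kzt; first by rewrite ifT //; lia.
rewrite ifN -?leqNgt; last by lia.
by rewrite addnA subnDA.
Qed.

Lemma cross_list_cat r1 r2 :
  cross_list (r1 ++ r2) = crossS (cross_list r1) (cross_list r2).
Proof.
elim: r1 => [|z r1 IH]; first by rewrite [cross_list [::]]/= crossS0l.
by rewrite /= -!/(cross_list _) IH crossSA.
Qed.

Lemma perm_of_fun a (f : nat -> nat) : (forall k, (k < a)%N -> (f k < a)%N) ->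
  (forall k l, (k < a)%N -> (l < a)%N -> f k = f l -> k = l) ->
  exists u : 'S_a, forall i : 'I_a, u i = f i :> nat.
Proof.
move=> fa finj; pose g (i : 'I_a) := Ordinal (fa i (ltn_ord i)).
have gi : injective g.
  by move=> i j /(congr1 val) /= /finj e; apply: val_inj; apply: e.
by exists (perm gi) => i; rewrite permE.
Qed.

(** By cardinality the complement of the prefix is invariant too; the factors are the restriction to
    the prefix and the restriction to the rest, moved down by j. *)
Lemma not_indecomposable z j : (0 < j < projT1 z)%N ->
  (forall k, (k < j)%N -> (spval z k < j)%N) -> ~ indecomposable z.
Proof.
move=> /andP[j0 jz] sj; apply.
have ge k : (j <= k < projT1 z)%N -> (j <= spval z k < projT1 z)%N.
  move=> /andP[jk kz]; rewrite spval_lt // andbT.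
  case: z jz sj kz => -[|n] w //= jz sj kz; rewrite spval_inord //.
  apply: stab_ge; last by rewrite jk.
  by move=> i ij; rewrite -spval_inord ?sj //; lia.
have [u hu] : exists u : 'S_j, forall i : 'I_j, u i = spval z i :> nat.
  by apply: perm_of_fun => // k l kj lj; apply: spval_inj; lia.
have [v hv] : exists v : 'S_(projT1 z - j),
    forall i : 'I_(projT1 z - j), v i = (spval z (i + j) - j)%N :> nat.
  apply: (perm_of_fun (f := fun k => (spval z (k + j) - j)%N)) => [k kj|k l kj lj e].
    by have := ge (k + j)%N; lia.
  have h1 := ge (k + j)%N; have h2 := ge (l + j)%N.
  have : (k + j = l + j)%N by apply: (@spval_inj z); lia.
  by lia.
exists j, (projT1 z - j)%N, u, v; split=> //; first by rewrite subn_gt0.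
apply: SP_ext => [|k]; first by rewrite /= subnKC // ltnW.
rewrite spval_cross /=; case: (ltnP k j) => kj; first by rewrite spvalE hu.
case: (ltnP k (projT1 z)) => kz; last first.
  by rewrite !spval_ge //=; lia.
have kzj : (k - j < projT1 z - j)%N by lia.
rewrite spvalE hv /= subnK //; have := ge k; lia.
Qed.

(** If j fell strictly inside the first factor, that factor would have a proper invariant prefix and
    decompose; otherwise the first factor is split off and j reduced by its size. *)
Lemma cut_complete (ws : seq SP) j :
  (forall u, List.In u ws -> (0 < projT1 u)%N /\ indecomposable u) ->
  (j <= projT1 (cross_list ws))%N ->
  (forall k, (k < j)%N -> (spval (cross_list ws) k < j)%N) ->
  exists2 i, (i <= size ws)%N & j = projT1 (cross_list (take i ws)).
Proof.
elim: ws j => [|z ws IH] j hws jl sj; first by exists 0%N => //; case: j jl sj.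
case: (posnP j) => [->|j0]; first by exists 0%N.
have [z0 iz] := hws z (or_introl erefl).
have hws' u : List.In u ws -> (0 < projT1 u)%N /\ indecomposable u.
  by move=> h; apply: hws; right.
rewrite [cross_list (z :: ws)]/= -/(cross_list _) in jl sj.
case: (ltnP j (projT1 z)) => jz.
  case: (@not_indecomposable z j _ _ iz); first by rewrite j0.
  by move=> k kj; have := sj k kj; rewrite spval_cross ifT //; lia.
have [|k kj|i hi e] := IH (j - projT1 z)%N hws'.
- by move: jl => /=; lia.
- have := sj (k + projT1 z)%N; rewrite spval_cross ifN ?addnK; last by lia.
  by lia.
exists i.+1 => //=; rewrite -/(cross_list _) -e; lia.
Qed.

Lemma size_cross_take (ws : seq SP) :
  (forall u, List.In u ws -> (0 < projT1 u)%N /\ indecomposable u) ->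
  forall i i', (i < i' <= size ws)%N ->
  (projT1 (cross_list (take i ws)) < projT1 (cross_list (take i' ws)))%N.
Proof.
elim: ws => [|z ws IH] hws i i'; first by case: i' => [|i'] /=; lia.
have [z0 _] := hws z (or_introl erefl).
have hws' u : List.In u ws -> (0 < projT1 u)%N /\ indecomposable u.
  by move=> h; apply: hws; right.
case: i' => // i' ii; case: i ii => [|i] ii; first by rewrite /= ltn_addr.
by rewrite /= ltn_add2l; apply: IH.
Qed.

(** Exchanging two blocks is conjugation by the rotation through the size of the first one. *)
Lemma aS_cshift n (U V : SP) (w : 'S_n.+1) : (projT1 U < n.+1)%N ->
  crossS U V = SPmk n.+1 w ->
  stab (projT1 U) w /\
  aS n.+1 (crossS V U) = a_ n.+1 (w ^ cshift_perm n (projT1 U))%g.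
Proof.
move=> Un e; have eS : (projT1 U + projT1 V)%N = n.+1 by have := congr1 (@projT1 _ _) e.
have sU : stab (projT1 U) w.
  by move=> k kU; rewrite -spval_inord -?e ?spval_cross ?kU ?spval_lt //; lia.
split=> //.
suff -> : crossS V U = SPmk n.+1 (w ^ cshift_perm n (projT1 U))%g by [].
apply: SP_ext => [|k] /=; first by rewrite addnC.
case: (ltnP k n.+1) => kn; last by rewrite !spval_ge //= addnC eS.
have [l ln el] : exists2 l, (l < n.+1)%N & k = cshift n (projT1 U) l.
  case: (ltnP k (projT1 V)) => kV.
    exists (k + projT1 U)%N; first by lia.
    rewrite /cshift (_ : k + projT1 U + (n.+1 - projT1 U) = k + n.+1)%N; last by lia.
    by rewrite modnDr modn_small.
  exists (k - projT1 V)%N; first by lia.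
  by rewrite /cshift modn_small; lia.
rewrite el spval_inord ?cshift_lt // -cshift_perm_inord // permJ.
rewrite -[w _]inord_val cshift_perm_inord ?ltn_ord // inordK ?cshift_lt // -spval_inord // -e.
rewrite !spval_cross; case: (ltnP l (projT1 U)) => lU.
  have h := spval_lt lU.
  have -> : cshift n (projT1 U) l = (projT1 V + l)%N by rewrite /cshift modn_small; lia.
  rewrite ltnNge leq_addr /= addKn /cshift modn_small; lia.
have -> : cshift n (projT1 U) l = (l - projT1 U)%N.
  by rewrite /cshift (_ : l + _ = l - projT1 U + n.+1)%N ?modnDr ?modn_small; lia.
have lV : (l - projT1 U < projT1 V)%N by lia.
have h := spval_lt lV; rewrite lV /cshift.
rewrite (_ : _ + (n.+1 - _) = spval V (l - projT1 U) + n.+1)%N; last by lia.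
by rewrite modnDr modn_small; lia.
Qed.

Theorem mainTheorem17 (n : nat) (w : 'S_n) (ws : seq SP) :
  (0 < n)%N ->
  len w = n.-1 ->
  (forall u, List.In u ws -> (0 < projT1 u)%N /\ indecomposable u) ->
  cross_list ws = existT (fun m => 'S_m) n w ->
  \sum_(i < size ws)
     aS n (crossS (cross_list (drop i ws)) (cross_list (take i ws)))
  = \sum_(a <- Red w) qK n ^+ comaj a.
Proof.
case: n w => // n w _ /= lw hws ew.
pose cut i := projT1 (cross_list (take i ws)).
have cut_size : cut (size ws) = n.+1 by rewrite /cut take_size ew.
have cut_lt (i : 'I_(size ws)) : (cut i < n.+1)%N.
  by rewrite -cut_size; apply: size_cross_take; rewrite // ltn_ord leqnn.
have split_w i : crossS (cross_list (take i ws)) (cross_list (drop i ws)) = SPmk n.+1 w.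
  by rewrite -cross_list_cat cat_take_drop.
have term (i : 'I_(size ws)) :
    aS n.+1 (crossS (cross_list (drop i ws)) (cross_list (take i ws))) =
    qfact_inv (qK n.+1) n * \sum_(a <- Red w) qK n.+1 ^+ comaj a *
      phi (KS n) (\prod_(t <- a) uu (KS n) (cshift n (cut i) t)).
  have [sw ->] := aS_cshift (cut_lt i) (split_w i).
  exact: (a_cshift (cut_lt i) sw lw).
(* After exchanging the sums, it remains to see for each reduced word that the terms of its cuts add
   up to 1; they are compared with the full sum [Psi]. *)
rewrite (eq_bigr _ (fun i _ => term i)) -big_distrr /= exchange_big big_distrr /=.
rewrite big_seq [RHS]big_seq; apply: eq_bigr => a; rewrite mem_Red => ra.
rewrite -big_distrr /= mulrCA -[RHS]mulr1; congr (_ * _).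
transitivity (qfact_inv (qK n.+1) n * Psi (KS n) a); last first.
  by apply: (qfact_inv_Psi (KS n)); rewrite (red_size ra).
congr (_ * _); pose co (i : 'I_(size ws)) : 'I_n.+1 := Ordinal (cut_lt i).
have co_inj : injective co.
  move=> i j /(congr1 val) /= e; apply: val_inj; case: (ltngtP i j) => // ij.
    have := size_cross_take hws (i := i) (i' := j); rewrite ij (ltnW (ltn_ord j)) => /(_ isT).
    by rewrite -/(cut i) -/(cut j) e ltnn.
  have := size_cross_take hws (i := j) (i' := i); rewrite ij (ltnW (ltn_ord i)) => /(_ isT).
  by rewrite -/(cut i) -/(cut j) e ltnn.
rewrite /Psi (bigID (mem (co @: [set: 'I_(size ws)]))) /= [X in _ = _ + X]big1 ?addr0; last first.
  (* A shift m that is not a cut: were m absent from a, w would preserve the prefix of length m, and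
     m would be a cut by [cut_complete]. So m occurs in a and contributes the factor u_0 = 0. *)
  move=> m mco; have ma : nat_of_ord m \in a.
    apply: contraT => ma; case/negP: mco.
    have sw : stab m w.
      have [->|m0] := posnP m; first by [].
      rewrite -(red_wp ra); apply: notin_stab => //; first by rewrite m0 ltn_ord.
      exact: red_letters ra.
    have [||i hi e] := @cut_complete ws m hws.
    - by rewrite ew /= ltnW.
    - move=> k km; rewrite ew spval_inord ?sw //; exact: ltn_trans km (ltn_ord m).
    (* The boundary after the last factor lies at n + 1 and so is not m. *)
    have li : (i < size ws)%N.
      move: hi; rewrite leq_eqVlt => /orP[/eqP ei|//].
      by have := ltn_ord m; rewrite e ei -/(cut _) cut_size ltnn.
    by apply/imsetP; exists (Ordinal li); rewrite ?inE //; apply: val_inj.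
  rewrite (big_rem _ ma) /= (_ : cshift n m m = 0%N) ?uu0 ?mul0r ?phi0 //.
  by apply/eqP; rewrite cshift_eq0.
rewrite (big_imset _ (in2W co_inj)) /=.
by apply: eq_bigl => i; rewrite inE.
Qed.
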